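(* Let $N>2$ be an integer. Any cleft quantum principal $H_{N^2}$-bundle over a commutative $k$-algebra $C$ in which $N$ is invertible is homotopically trivial.
   Context: Fix a field $k$. All algebras are associative unital $k$-algebras, algebra morphisms preserve units, and $\otimes$ without subscript means $\otimes_k$. For a Hopf algebra $H$ write $\Delta(h)=\sum_{(h)}h_{(1)}\otimes h_{(2)}$ for its coproduct and $\varepsilon$ for its counit. Taft's Hopf algebra $H_{N^2}$, for a fixed integer $N>2$, is the $k$-algebra (of dimension $N^2$) generated by $X,Y$ subject to the relations $X^N=1$, $Y^N=0$, $YX=qXY$, where $q\in k$ is a root of unity of order $N$; its coproduct and counit are given by $\Delta(X)=X\otimes X$, $\Delta(Y)=1\otimes Y+Y\otimes X$, $\varepsilon(X)=1$, $\varepsilon(Y)=0$. An $H$-comodule algebra is an algebra $A$ with a right $H$-comodule structure whose coaction $\Delta_A: A\to A\otimes H$ is a morphism of algebras. Its base is the subalgebra of coinvariants $A^{\mathrm{co}\,H}=\{a\in A : \Delta_A(a)=a\otimes 1_H\}$; if $C=A^{\mathrm{co}\,H}$ one says that $C\subset A$ is an $H$-extension. It is Galois if the map $A\otimes_C A\to A\otimes H$, $a\otimes b\mapsto (a\otimes 1_H)\Delta_A(b)$, is bijective. For a commutative algebra $C$, a quantum principal $H$-bundle over (with base) $C$ is a Galois $H$-extension $C\subset A$ such that $C$ is central in $A$ and $A$ is faithfully flat as a $C$-module. Two such bundles are isomorphic ($\cong$) if there is an isomorphism of $H$-comodule algebras between them. For a morphism $f:C\to C'$ of commutative algebras, the push-forward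 of a quantum principal $H$-bundle $A$ over $C$ is $f_*A=C'\otimes_C A$ with multiplication $(c_1'\otimes a_1)(c_2'\otimes a_2)=c_1'c_2'\otimes a_1a_2$ and coaction $\mathrm{id}_{C'}\otimes_C\Delta_A$; it is a quantum principal $H$-bundle over $C'$. For a commutative algebra $K$, let $[0],[1]:K[t]\to K$ be the $K$-algebra morphisms sending $t$ to $0$ and $1$ respectively. Let $\mathcal{C}_{\text{ét}}$ be the class of finite étale morphisms of commutative algebras. For two quantum principal $H$-bundles $A,A'$ over $C$, write $A\sim A'$ if there exist a morphism $i:C\to\bar C$ in $\mathcal{C}_{\text{ét}}$ and a quantum principal $H$-bundle $B$ with base $\bar C[t]$ such that $[0]_*B\cong i_*A$ and $[1]_*B\cong i_*A'$. Homotopy equivalence of quantum principal $H$-bundles over $C$ is the equivalence relation generated by $\sim$. A quantum principal $H$-bundle over $C$ is trivial if it is isomorphic to the $H$-comodule algebra $C\otimes H$ with coaction $\mathrm{id}_C\otimes\Delta$; it is homotopically trivial if it is homotopy equivalent to a trivial quantum principal $H$-bundle over $C$. An $H$-extension $C\subset A$ is cleft if there exists a morphism $\gamma:H\to A$ of right $H$-comodules that is convolution invertible, i.e. there is a linear map $\gamma':H\to A$ with $\sum_{(h)}\gamma(h_{(1)})\gamma'(h_{(2)})=\sum_{(h)}\gamma'(h_{(1)})\gamma(h_{(2)})=\varepsilon(h)1_A$ for all $h\in H$. *)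

(* Defs.v *)
From HB Require Import structures.
From mathcomp Require Import all_boot all_algebra.
From mathcomp Require Import boolp freeg mpoly.
From Stdlib Require Import Relation_Operators.

Set Implicit Arguments.
Unset Strict Implicit.
Unset Printing Implicit Defensive.

Import GRing.Theory.
Local Open Scope ring_scope.

Reserved Notation "m \ox n" (at level 40, left associativity).

(* The tensor product of two modules over a commutative ring: the free abelian
   group on M * N modulo the subgroup generated by the bilinearity relators. *)
Section TensorProduct.
Variables (R : comPzRingType) (M N : lmodType R).

Inductive tensor_rel : {freeg (M * N) / int} -> Prop :=
| Tensor_rel0 : tensor_rel 0
| Tensor_relB x y : tensor_rel x -> tensor_rel y -> tensor_rel (x - y)
| Tensor_relDl m1 m2 n :
    tensor_rel (<< (m1 + m2, n) >> - << (m1, n) >> - << (m2, n) >>)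
| Tensor_relDr m n1 n2 :
    tensor_rel (<< (m, n1 + n2) >> - << (m, n1) >> - << (m, n2) >>)
| Tensor_relZ r m n : tensor_rel (<< (r *: m, n) >> - << (m, r *: n) >>).

Definition tensor_relb : pred {freeg (M * N) / int} :=
  fun x => `[< tensor_rel x >].

Lemma tensor_relb_closed : zmod_closed tensor_relb.
Proof.
split=> [|x y /asboolP xr /asboolP yr]; apply/asboolP.
  exact: Tensor_rel0.
exact: Tensor_relB.
Qed.

HB.instance Definition _ :=
  GRing.isZmodClosed.Build {freeg (M * N) / int} tensor_relb tensor_relb_closed.

Definition tensor_relators : zmodClosed {freeg (M * N) / int} := GRing.ZmodClosed.clone _ tensor_relb _.

Definition tensor : Type := Quotient.quot tensor_relators.

HB.instance Definition _ := GRing.Zmodule.on tensor.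

Definition tmul (m : M) (n : N) : tensor :=
  \pi_(Quotient.quot tensor_relators)%qT << (m, n) >>.

(* The additive map determined by m \ox n |-> f m n; it is only meaningful when
   f is biadditive and balanced (tliftE). *)
Definition tlift (Z : zmodType) (f : M -> N -> Z) (t : tensor) : Z :=
  fglift (fun p => f p.1 p.2 : zmodule Z) (repr (t : Quotient.quot tensor_relators)).

Definition balanced (Z : zmodType) (f : M -> N -> Z) : Prop :=
  [/\ forall m1 m2 n, f (m1 + m2) n = f m1 n + f m2 n,
      forall m n1 n2, f m (n1 + n2) = f m n1 + f m n2
    & forall r m n, f (r *: m) n = f m (r *: n)].

Section Theory.
Local Open Scope quotient_scope.
Local Notation Q := (Quotient.quot tensor_relators).
Local Notation "m \ox n" := (tmul m n).

Lemma tensor_eqP (x y : {freeg (M * N) / int}) :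
  (\pi_Q x == \pi_Q y) = tensor_relb (x - y).
Proof. by rewrite eqmodE. Qed.

Lemma pi_tensorD x y : \pi_Q (x + y) = (\pi_Q x : tensor) + \pi_Q y.
Proof. exact: Quotient.pi_add. Qed.

Lemma tmulDl m1 m2 n : (m1 + m2) \ox n = m1 \ox n + m2 \ox n.
Proof.
apply: (@etrans _ _ (\pi_Q (<< (m1, n) >> + << (m2, n) >>))); last first.
  exact: Quotient.pi_add.
by apply/eqP; rewrite tensor_eqP opprD addrA; apply/asboolP/Tensor_relDl.
Qed.

Lemma tmulDr m n1 n2 : m \ox (n1 + n2) = m \ox n1 + m \ox n2.
Proof.
apply: (@etrans _ _ (\pi_Q (<< (m, n1) >> + << (m, n2) >>))); last first.
  exact: Quotient.pi_add.
by apply/eqP; rewrite tensor_eqP opprD addrA; apply/asboolP/Tensor_relDr.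
Qed.

Lemma tmulZ r m n : (r *: m) \ox n = m \ox (r *: n).
Proof. by apply/eqP; rewrite tensor_eqP; apply/asboolP/Tensor_relZ. Qed.

Lemma tmul0l n : 0 \ox n = 0.
Proof. by apply: (addrI (0 \ox n)); rewrite -tmulDl !addr0. Qed.

Lemma tmul0r m : m \ox 0 = 0.
Proof. by apply: (addrI (m \ox 0)); rewrite -tmulDr !addr0. Qed.

Lemma tmulNl m n : (- m) \ox n = - (m \ox n).
Proof. by apply: (addrI (m \ox n)); rewrite -tmulDl !subrr tmul0l. Qed.

Lemma tensor_ind (P : tensor -> Prop) :
    (forall m n, P (m \ox n)) -> (forall s t, P s -> P t -> P (s + t)) ->
  forall t, P t.
Proof.
move=> Pm PD.
pose S x := P (\pi_Q x).
have SD x y : S x -> S y -> S (x + y).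
  by move=> Sx Sy; rewrite /S Quotient.pi_add; apply: PD.
have SU p : S << p >> by case: p => m n; apply: Pm.
have SN p : S (- << p >>).
  by case: p => m n; rewrite /S Quotient.pi_opp -[X in P X]tmulNl; apply: Pm.
have S0 : S 0 by rewrite -(subrr << (0, 0) >>); apply: SD.
have SM n x : S x -> S (x *+ n).
  by move=> Sx; elim: n => [|n IHn]; rewrite ?mulr0n // mulrS; apply: SD.
have S_all x : S x.
  apply: freeg_ind_dom0 x => // a p D _ _ SD'; apply: SD => //.
  rewrite -[a]intz -freegU_mulz; case: a => n; first exact: SM.
  by rewrite NegzE mulrNz -mulNrz; apply: SM.
by move=> t; rewrite -[t]reprK; apply: S_all.
Qed.

Section Lift.
Variables (Z : zmodType) (f : M -> N -> Z).
Hypothesis f_bal : balanced f.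

Let F : {freeg (M * N) / int} -> zmodule Z :=
  fglift (fun p => f p.1 p.2 : zmodule Z).

Let FB x y : F (x - y) = F x - F y.
Proof. exact: lift_is_additive. Qed.

Let F0 : F 0 = 0.
Proof. by rewrite -(subrr 0) FB subrr. Qed.

Let FD x y : F (x + y) = F x + F y.
Proof. by rewrite -{1}[y]opprK FB -[- y]sub0r FB F0 sub0r opprK. Qed.

Let FU p : F << p >> = f p.1 p.2.
Proof. by rewrite /F liftU scale1r. Qed.

Let tlift_pi x : tlift f (\pi_Q x) = F x.
Proof.
have Frel y : tensor_rel y -> F y = 0.
  have [fDl fDr fZ] := f_bal.
  elim=> [|{}y z _ Fy _ Fz|m1 m2 n|m n1 n2|r m n].
  - exact: F0.
  - by rewrite FB Fy Fz subrr.
  - by rewrite !FB !FU /= fDl -addrA -opprD subrr.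
  - by rewrite !FB !FU /= fDr -addrA -opprD subrr.
  - by rewrite FB !FU /= fZ subrr.
apply/eqP; rewrite /tlift -/F -subr_eq0 -FB; apply/eqP/Frel/asboolP.
by rewrite -/(tensor_relb _) -tensor_eqP reprK.
Qed.

Lemma tliftE m n : tlift f (m \ox n) = f m n.
Proof. by rewrite tlift_pi FU. Qed.

Lemma tliftD s t : tlift f (s + t) = tlift f s + tlift f t.
Proof.
by rewrite -[s]reprK -[t]reprK -pi_tensorD !tlift_pi FD.
Qed.

Lemma tlift0 : tlift f 0 = 0.
Proof. by apply: (addrI (tlift f 0)); rewrite -tliftD !addr0. Qed.

End Lift.
End Theory.
End TensorProduct.

Notation "m \ox n" := (tmul m n) : ring_scope.

Section TensorModule.
Variables (R : comPzRingType) (M N : lmodType R).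
Implicit Types (r : R) (t : tensor M N).

Definition tensor_scale r t : tensor M N :=
  tlift (fun m n => (r *: m) \ox n) t.

Let bal r : balanced (fun (m : M) (n : N) => (r *: m) \ox n).
Proof.
split=> [m1 m2 n|m n1 n2|a m n].
- by rewrite scalerDr tmulDl.
- by rewrite tmulDr.
- by rewrite scalerA mulrC -scalerA tmulZ.
Qed.

Lemma tensor_scaleE r m n : tensor_scale r (m \ox n) = (r *: m) \ox n.
Proof. exact: tliftE. Qed.

Lemma tensor_scaleDr : right_distributive tensor_scale +%R.
Proof. by move=> r s t; rewrite /tensor_scale tliftD. Qed.

Lemma tensor_scaleA a b t :
  tensor_scale a (tensor_scale b t) = tensor_scale (a * b) t.
Proof.
elim/tensor_ind: t => [m n|s t IHs IHt].
  by rewrite !tensor_scaleE scalerA.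
by rewrite !tensor_scaleDr IHs IHt.
Qed.

Lemma tensor_scale1 : left_id 1 tensor_scale.
Proof.
elim/tensor_ind=> [m n|s t IHs IHt]; first by rewrite tensor_scaleE scale1r.
by rewrite tensor_scaleDr IHs IHt.
Qed.

Lemma tensor_scaleDl t : {morph tensor_scale^~ t : a b / a + b}.
Proof.
move=> a b; elim/tensor_ind: t => [m n|s t IHs IHt].
  by rewrite !tensor_scaleE scalerDl tmulDl.
by rewrite !tensor_scaleDr IHs IHt addrACA.
Qed.

HB.instance Definition _ :=
  GRing.Zmodule_isLmodule.Build R (tensor M N) tensor_scaleA tensor_scale1
    tensor_scaleDr tensor_scaleDl.

Lemma tensorZl r m n : r *: (m \ox n) = (r *: m) \ox n.
Proof. exact: tensor_scaleE. Qed.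

Lemma tensorZr r m n : r *: (m \ox n) = m \ox (r *: n).
Proof. by rewrite tensorZl tmulZ. Qed.

End TensorModule.

Definition tmap (R : comPzRingType) (M M' N N' : lmodType R)
    (f : M -> M') (g : N -> N') : tensor M N -> tensor M' N' :=
  tlift (fun m n => f m \ox g n).

Definition tassoc (R : comPzRingType) (M N P : lmodType R) :
    tensor (tensor M N) P -> tensor M (tensor N P) :=
  tlift (fun t p => tlift (fun m n => m \ox (n \ox p)) t).

(* Associative unital algebras. Unlike for algType, the zero algebra is allowed:
   a tensor product of nonzero algebras over a ring may be zero. *)
Record assocAlg (R : comPzRingType) := AssocAlg {
  alg_lmod : lmodType R;
  alg_one : alg_lmod;
  alg_mul : alg_lmod -> alg_lmod -> alg_lmod;
  alg_mulA : associative alg_mul;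
  alg_mul1l : left_id alg_one alg_mul;
  alg_mul1r : right_id alg_one alg_mul;
  alg_mulDl : left_distributive alg_mul +%R;
  alg_mulDr : right_distributive alg_mul +%R;
  alg_mulZl : forall r x y, alg_mul (r *: x) y = r *: alg_mul x y;
  alg_mulZr : forall r x y, alg_mul x (r *: y) = r *: alg_mul x y
}.

Definition alg_sort (R : comPzRingType) (A : assocAlg R) : Type := alg_lmod A.
Coercion alg_sort : assocAlg >-> Sortclass.

HB.instance Definition _ (R : comPzRingType) (A : assocAlg R) :=
  GRing.Lmodule.copy (alg_sort A) (alg_lmod A).

HB.instance Definition _ (R : comPzRingType) (A : assocAlg R) :=
  GRing.Zmodule_isPzRing.Build (alg_sort A) (@alg_mulA R A) (@alg_mul1l R A)
    (@alg_mul1r R A) (@alg_mulDl R A) (@alg_mulDr R A).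

Lemma alg_scaleAl (R : comPzRingType) (A : assocAlg R) r (x y : A) :
  r *: (x * y) = (r *: x) * y.
Proof. by rewrite [RHS]alg_mulZl. Qed.

Lemma alg_scaleAr (R : comPzRingType) (A : assocAlg R) r (x y : A) :
  r *: (x * y) = x * (r *: y).
Proof. by rewrite [RHS]alg_mulZr. Qed.

Definition algebra_morphism (R : comPzRingType) (A B : assocAlg R)
    (f : A -> B) : Prop := linear f /\ monoid_morphism f.

Definition regular_alg (R : comPzRingType) : assocAlg R :=
  @AssocAlg R R^o 1 *%R (@mulrA R) (@mul1r R) (@mulr1 R) (@mulrDl R)
    (@mulrDr R) (fun r x y => esym (@mulrA R r x y))
    (fun r x y => @mulrCA R x r y).

Section TensorAlgebra.
Variables (R : comPzRingType) (A B : assocAlg R).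
Local Notation AB := (tensor (alg_sort A) (alg_sort B)).
Implicit Types s t u : AB.

Definition tensor_one : AB := (1 : A) \ox (1 : B).

Definition tensor_mul s t : AB :=
  tlift (fun (a : A) (b : B) =>
    tlift (fun (a' : A) (b' : B) => (a * a') \ox (b * b')) t) s.

Let bal (a : A) (b : B) :
  balanced (fun (a' : A) (b' : B) => (a * a') \ox (b * b')).
Proof.
split=> [x y z|x y z|r x y].
- by rewrite mulrDr tmulDl.
- by rewrite mulrDr tmulDr.
- by rewrite -!alg_scaleAr tmulZ.
Qed.

Let bal2 t : balanced (fun (a : A) (b : B) =>
  tlift (fun (a' : A) (b' : B) => (a * a') \ox (b * b')) t).
Proof.
split=> [x y z|x y z|r x y].
- elim/tensor_ind: t => [a b|s t IHs IHt].
    by rewrite !tliftE // mulrDl tmulDl.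
  by rewrite !tliftD // IHs IHt addrACA.
- elim/tensor_ind: t => [a b|s t IHs IHt].
    by rewrite !tliftE // mulrDl tmulDr.
  by rewrite !tliftD // IHs IHt addrACA.
- elim/tensor_ind: t => [a b|s t IHs IHt].
    by rewrite !tliftE // -!alg_scaleAl tmulZ.
  by rewrite !tliftD // IHs IHt.
Qed.

Lemma tensor_mulE (a a' : A) (b b' : B) :
  tensor_mul (a \ox b) (a' \ox b') = (a * a') \ox (b * b').
Proof. by rewrite /tensor_mul !tliftE. Qed.

Lemma tensor_mulDl : left_distributive tensor_mul +%R.
Proof. by move=> s t u; rewrite /tensor_mul tliftD. Qed.

Lemma tensor_mulDr : right_distributive tensor_mul +%R.
Proof.
move=> s t u; elim/tensor_ind: s => [a b|s s' IHs IHs'].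
  by rewrite /tensor_mul !(tliftE (bal2 _)) tliftD.
by rewrite !tensor_mulDl IHs IHs' addrACA.
Qed.

Lemma tensor_mulA : associative tensor_mul.
Proof.
move=> s t u; elim/tensor_ind: s => [a b|s s' IHs IHs']; last first.
  by rewrite !tensor_mulDl IHs IHs'.
elim/tensor_ind: t => [a' b'|t t' IHt IHt']; last first.
  by rewrite tensor_mulDl !tensor_mulDr tensor_mulDl IHt IHt'.
elim/tensor_ind: u => [a'' b''|u u' IHu IHu']; last first.
  by rewrite !tensor_mulDr IHu IHu'.
by rewrite !tensor_mulE !mulrA.
Qed.

Lemma tensor_mul1l : left_id tensor_one tensor_mul.
Proof.
elim/tensor_ind=> [a b|s t IHs IHt]; first by rewrite tensor_mulE !mul1r.
by rewrite tensor_mulDr IHs IHt.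
Qed.

Lemma tensor_mul1r : right_id tensor_one tensor_mul.
Proof.
elim/tensor_ind=> [a b|s t IHs IHt]; first by rewrite tensor_mulE !mulr1.
by rewrite tensor_mulDl IHs IHt.
Qed.

Lemma tensor_mulZl r s t : tensor_mul (r *: s) t = r *: tensor_mul s t.
Proof.
elim/tensor_ind: s => [a b|s s' IHs IHs']; last first.
  by rewrite scalerDr !tensor_mulDl scalerDr IHs IHs'.
elim/tensor_ind: t => [a' b'|t t' IHt IHt']; last first.
  by rewrite !tensor_mulDr scalerDr IHt IHt'.
by rewrite tensorZl !tensor_mulE tensorZl alg_scaleAl.
Qed.

Lemma tensor_mulZr r s t : tensor_mul s (r *: t) = r *: tensor_mul s t.
Proof.
elim/tensor_ind: s => [a b|s s' IHs IHs']; last first.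
  by rewrite !tensor_mulDl scalerDr IHs IHs'.
elim/tensor_ind: t => [a' b'|t t' IHt IHt']; last first.
  by rewrite scalerDr !tensor_mulDr scalerDr IHt IHt'.
by rewrite tensorZl !tensor_mulE tensorZl alg_scaleAr.
Qed.

Definition tensor_alg : assocAlg R :=
  @AssocAlg R AB tensor_one tensor_mul tensor_mulA tensor_mul1l
    tensor_mul1r tensor_mulDl tensor_mulDr tensor_mulZl tensor_mulZr.

End TensorAlgebra.

(* The R-algebra obtained from an S-algebra by restriction of scalars along
   f : R -> S. *)
Section Restriction.
Variables (R S : comPzRingType) (f : {rmorphism R -> S}) (A : assocAlg S).

Definition restriction of {rmorphism R -> S} : Type := A.
Local Notation fA := (restriction f).

HB.instance Definition _ := GRing.Zmodule.on fA.

Definition restriction_scale (r : R) (x : fA) : fA := f r *: (x : A).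

Lemma restriction_scaleA a b x :
  restriction_scale a (restriction_scale b x) = restriction_scale (a * b) x.
Proof. by rewrite /restriction_scale scalerA rmorphM. Qed.

Lemma restriction_scale1 : left_id 1 restriction_scale.
Proof. by move=> x; rewrite /restriction_scale rmorph1 scale1r. Qed.

Lemma restriction_scaleDr : right_distributive restriction_scale +%R.
Proof. by move=> r x y; rewrite /restriction_scale scalerDr. Qed.

Lemma restriction_scaleDl x : {morph restriction_scale^~ x : a b / a + b}.
Proof. by move=> a b; rewrite /restriction_scale rmorphD scalerDl. Qed.

HB.instance Definition _ :=
  GRing.Zmodule_isLmodule.Build R fA restriction_scaleA restriction_scale1
    restriction_scaleDr restriction_scaleDl.

Definition restrict : assocAlg R :=
  @AssocAlg R fA (1 : A) (fun x y : A => x * y) (@mulrA A) (@mul1r A) (@mulr1 A)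
    (@mulrDl A) (@mulrDr A) (fun r => @alg_mulZl S A (f r))
    (fun r => @alg_mulZr S A (f r)).

End Restriction.

(* The S-algebra S \ox_R A obtained from an R-algebra A along f : R -> S. *)
Section BaseChange.
Variables (R S : comPzRingType) (f : {rmorphism R -> S}) (A : assocAlg R).

Local Notation fS := (restrict f (regular_alg S)).
Local Notation SA := (tensor_alg fS A).

Definition base_change_carrier : Type := SA.
HB.instance Definition _ := GRing.Zmodule.on base_change_carrier.

Definition base_change_scale (s : S) (x : base_change_carrier) :
  base_change_carrier := ((s : fS) \ox (1 : A) : SA) * (x : SA).

Lemma base_change_scaleA a b x :
  base_change_scale a (base_change_scale b x) = base_change_scale (a * b) x.
Proof.
by rewrite /base_change_scale mulrA [X in X * _]tensor_mulE mulr1.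
Qed.

Lemma base_change_scale1 : left_id 1 base_change_scale.
Proof. exact: (@mul1r SA). Qed.

Lemma base_change_scaleDr : right_distributive base_change_scale +%R.
Proof. by move=> s x y; rewrite /base_change_scale mulrDr. Qed.

Lemma base_change_scaleDl x : {morph base_change_scale^~ x : a b / a + b}.
Proof.
by move=> a b; rewrite /base_change_scale -mulrDl; congr (_ * _); apply: tmulDl.
Qed.

HB.instance Definition _ :=
  GRing.Zmodule_isLmodule.Build S base_change_carrier base_change_scaleA
    base_change_scale1 base_change_scaleDr base_change_scaleDl.

Lemma base_change_mulZl (s : S) (x y : SA) :
  (base_change_scale s x : SA) * y = base_change_scale s (x * y).
Proof. by rewrite /base_change_scale mulrA. Qed.

Lemma base_change_mulZr (s : S) (x y : SA) :
  x * (base_change_scale s y : SA) = base_change_scale s (x * y).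
Proof.
rewrite /base_change_scale !mulrA; congr (_ * y).
elim/tensor_ind: x => [s' a|x x' IHx IHx'].
  rewrite [LHS]tensor_mulE [RHS]tensor_mulE; congr (_ \ox _).
    exact: (@mulrC S).
  by rewrite mul1r mulr1.
by rewrite [LHS]mulrDl [RHS]mulrDr IHx IHx'.
Qed.

Definition base_change : assocAlg S :=
  @AssocAlg S base_change_carrier (1 : SA) (fun x y : SA => x * y) (@mulrA SA)
    (@mul1r SA) (@mulr1 SA) (@mulrDl SA) (@mulrDr SA) base_change_mulZl
    base_change_mulZr.

Definition base_change_tmul (s : S) (a : A) : base_change := (s : fS) \ox a.

Lemma base_changeZ (s s' : S) (a : A) :
  s *: base_change_tmul s' a = base_change_tmul (s * s') a.
Proof. by rewrite [LHS]tensor_mulE mul1r. Qed.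

End BaseChange.

Section HopfAlgebra.
Variable k : fieldType.

Record hopfAlgebra := HopfAlgebra {
  hopf_alg :> assocAlg k;
  comul : hopf_alg -> tensor_alg hopf_alg hopf_alg;
  counit : hopf_alg -> k;
  antipode : hopf_alg -> hopf_alg;
  comul_morph : algebra_morphism comul;
  counit_morph : @algebra_morphism k hopf_alg (regular_alg k) counit;
  antipode_linear : linear antipode;
  comulA : forall h, tassoc (tmap comul id (comul h)) = tmap id comul (comul h);
  comul_counitl :
    forall h, tlift (fun x y : hopf_alg => counit x *: y) (comul h) = h;
  comul_counitr :
    forall h, tlift (fun x y : hopf_alg => counit y *: x) (comul h) = h;
  comul_antipodel :
    forall h, tlift (fun x y : hopf_alg => antipode x * y) (comul h)
              = counit h *: (1 : hopf_alg);
  comul_antipoder :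
    forall h, tlift (fun x y : hopf_alg => x * antipode y) (comul h)
              = counit h *: (1 : hopf_alg)
}.

Definition taft_relations (N : nat) (q : k) (B : assocAlg k) (x y : B) : Prop :=
  [/\ x ^+ N = 1, y ^+ N = 0 & y * x = q *: (x * y)].

(* H is the algebra presented by the generators X, Y and the Taft relations. *)
Definition is_taft (N : nat) (q : k) (H : hopfAlgebra) : Prop :=
  exists X Y : H,
  [/\ taft_relations N q X Y,
      forall (B : assocAlg k) (x y : B), taft_relations N q x y ->
        exists2 f : H -> B, [/\ algebra_morphism f, f X = x & f Y = y]
          & forall g : H -> B, algebra_morphism g -> g X = x -> g Y = y ->
              g =1 f,
      exists f : {linear 'rV[k]_(N ^ 2) -> alg_sort H}, bijective f,
      comul X = X \ox X /\ comul Y = (1 : H) \ox Y + Y \ox X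
    & counit X = 1 /\ counit Y = 0].

Variable H : hopfAlgebra.

Definition convolution (A : assocAlg k) (f g : H -> A) (h : H) : A :=
  tlift (fun x y : H => f x * g y) (comul h).

Record coactedAlg := CoactedAlg {
  ca_alg :> assocAlg k;
  coact : ca_alg -> tensor_alg ca_alg H
}.

Definition comodule_algebra (A : coactedAlg) : Prop :=
  [/\ algebra_morphism (@coact A),
      forall a : A, tassoc (tmap (@coact A) id (coact a))
                    = tmap id (@comul H) (coact a)
    & forall a : A, tlift (fun (x : A) (h : H) => counit h *: x) (coact a) = a].

(* No compatibility with the base of A and A' is required. *)
Definition comodule_alg_iso (A A' : coactedAlg) : Prop :=
  exists theta : A -> A',
  [/\ algebra_morphism theta, bijective theta
    & forall a : A, coact (theta a) = tmap theta id (coact a)].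

Definition cleft (A : coactedAlg) : Prop :=
  exists gamma gamma' : H -> A,
  [/\ linear gamma,
      forall h, coact (gamma h) = tmap gamma id (comul h),
      linear gamma'
    & forall h, convolution gamma gamma' h = counit h *: (1 : A)
                /\ convolution gamma' gamma h = counit h *: (1 : A)].

End HopfAlgebra.
Arguments coact {k H} c.

Section Extension.
Variables (k : fieldType) (H : hopfAlgebra k).

(* C is a k-algebra through phi, and is nonzero: the zero ring, which is finite
   etale over every C, would make any two bundles homotopy equivalent. As C
   is central in the bundles considered, the inclusion of C in A is encoded by a
   C-algebra structure on A. *)
Record extension_data (C : comNzRingType) (phi : {rmorphism k -> C}) :=
  ExtensionData {
    ext_alg : assocAlg C;
    ext_coact : restrict phi ext_alg -> tensor_alg (restrict phi ext_alg) H
  }.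

Variables (C : comNzRingType) (phi : {rmorphism k -> C}).
Implicit Types E : extension_data phi.

Definition ext_coacted E : coactedAlg H := CoactedAlg (@ext_coact _ _ E).
Coercion ext_coacted : extension_data >-> coactedAlg.

(* C -> A is injective and its image is the algebra of coinvariants. *)
Definition is_extension E : Prop :=
  [/\ comodule_algebra E,
      injective (fun c : C => c *: (1 : ext_alg E))
    & forall a : ext_alg E,
        coact E a = (a : E) \ox (1 : H) <-> exists c : C, a = c *: (1 : ext_alg E)].

Definition galois_map E : tensor (alg_sort (ext_alg E)) (alg_sort (ext_alg E))
    -> tensor_alg E H :=
  tlift (fun a b : ext_alg E =>
    ((a : E) \ox (1 : H) : tensor_alg E H) * coact E b).

Definition exact_at (M1 M2 M3 : zmodType) (f : M1 -> M2) (g : M2 -> M3) : Prop :=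
  forall y, g y = 0 <-> exists x, f x = y.

Definition faithfully_flat (R : comPzRingType) (A : lmodType R) : Prop :=
  forall (M1 M2 M3 : lmodType R) (f : {linear M1 -> M2}) (g : {linear M2 -> M3}),
    exact_at f g <-> exact_at (@tmap R A A M1 M2 id f) (@tmap R A A M2 M3 id g).

Definition is_bundle E : Prop :=
  [/\ is_extension E, bijective (@galois_map E)
    & faithfully_flat (alg_sort (ext_alg E))].

(* Quantum principal H-bundles with base C. *)
Record bundle := Bundle {
  bundle_ext :> extension_data phi;
  bundleP : is_bundle bundle_ext
}.

Definition trivial_ext : extension_data phi :=
  @ExtensionData C phi (base_change phi H)
    (tlift (fun (c : restrict phi (regular_alg C)) (h : H) =>
       tmap (fun x : H =>
               base_change_tmul phi c x : restrict phi (base_change phi H))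
            id (comul h))).

Definition trivial_bundle E : Prop := comodule_alg_iso E trivial_ext.

Variables (C' : comNzRingType) (f : {rmorphism C -> C'}).

(* f_* E = C' \ox_C E. *)
Definition push_forward E : extension_data (f \o phi) :=
  @ExtensionData C' (f \o phi) (base_change f (ext_alg E))
    (tlift (fun (c : restrict f (regular_alg C')) (a : ext_alg E) =>
       tmap (fun x : E => base_change_tmul f c (x : ext_alg E)
               : restrict (f \o phi) (base_change f (ext_alg E)))
            id (coact E a))).

End Extension.

Section FiniteEtale.
Variables (C D : comNzRingType) (f : {rmorphism C -> D}).

Definition finite_morphism : Prop :=
  exists s : seq D, forall x, exists c : nat -> C,
    x = \sum_(i < size s) f (c i) * s`_i.

Definition finitely_presented : Prop :=
  exists n (pi : {rmorphism {mpoly C[n]} -> D}) (rels : seq {mpoly C[n]}),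
  [/\ forall c, pi c%:MP = f c,
      forall x, exists p, pi p = x
    & forall p, pi p = 0 <->
        exists a : nat -> {mpoly C[n]}, p = \sum_(i < size rels) a i * rels`_i].

(* Unique lifting against all ring morphisms S -> S' that are surjective
   with square-zero kernel. *)
Definition formally_etale : Prop :=
  forall (S S' : comPzRingType) (p : {rmorphism S -> S'})
         (g : {rmorphism C -> S}) (h : {rmorphism D -> S'}),
    (forall x, exists y, p y = x) ->
    (forall x y, p x = 0 -> p y = 0 -> x * y = 0) ->
    h \o f =1 p \o g ->
  exists2 l : {rmorphism D -> S}, l \o f =1 g /\ p \o l =1 h
    & forall l' : {rmorphism D -> S}, l' \o f =1 g -> p \o l' =1 h -> l' =1 l.

(* Etale means formally etale and of finite presentation. *)
Definition finite_etale : Prop :=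
  [/\ finite_morphism, finitely_presented & formally_etale].

End FiniteEtale.

Section Homotopy.
Variables (k : fieldType) (H : hopfAlgebra k).
Variables (C : comNzRingType) (phi : {rmorphism k -> C}).

(* The base of B is Cbar[t], with the k-algebra structure induced by that of C;
   horner_eval 0 and horner_eval 1 are the evaluations [0] and [1]. *)
Definition elementary_homotopic (A A' : bundle H phi) : Prop :=
  exists (Cbar : comNzRingType) (i : {rmorphism C -> Cbar})
         (B : bundle H (polyC \o (i \o phi))),
  [/\ finite_etale i,
      comodule_alg_iso (push_forward (horner_eval 0) B) (push_forward i A)
    & comodule_alg_iso (push_forward (horner_eval 1) B) (push_forward i A')].

Definition homotopy_equivalent : bundle H phi -> bundle H phi -> Prop :=
  clos_refl_sym_trans _ elementary_homotopic.

Definition homotopically_trivial (A : bundle H phi) : Prop :=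
  exists2 T : bundle H phi, trivial_bundle T & homotopy_equivalent A T.

End Homotopy.

(* Main.v *)
From HB Require Import structures.
From mathcomp Require Import all_boot all_algebra ring.
From mathcomp Require Import boolp mpoly.
From Stdlib Require Import Relation_Operators.
Require Import Defs.

Set Implicit Arguments.
Unset Strict Implicit.
Unset Printing Implicit Defensive.

Import GRing.Theory.
Local Open Scope ring_scope.

(** A cleaving map of A provides x = gamma(X), invertible and with coaction
    x \ox X, and y with coaction 1 \ox Y + y \ox X. Coinvariance forces
    x^N = a and y^N = b with a, b in the base and a a unit, and
    yx = qxy + c x^2; since 1 - q is invertible, c is killed by adding a
    multiple of x to y. Hence A receives a morphism from the comodule algebra
    E(a, b) presented by x^N = a, y^N = b, yx = qxy; comparing Galois maps, it
    becomes bijective after tensoring with A over the base, so it is bijective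
    by faithful flatness. After the finite etale extension adjoining an N-th
    root of a (this is where N must be invertible) one may take a = 1, and
    E(1, tb) is a homotopy from E(1, 0), which is trivial, to E(1, b). *)

(** * Adjoining an N-th root of a unit is finite etale *)

(** Why a and b are treated differently: E(a, b) is Galois for every b, but only because x is
    invertible, so a must stay a unit. A straight path tb is therefore allowed in the second
    parameter, whereas a path 1 - t + ta from 1 to a does not in general consist of units; a has to
    be removed by the etale extension, through x |-> x/z with z^N = a.

    The comparison of Galois maps rests on an explicit inverse. Over A, the map from A \ox E(a, b)
    to A \ox H is inverted by a translation map defined on H through its universal property; the
    only real computation is that two elements of A^op \ox E(a, b) satisfy the Taft relations.
    Taking E(a, b) itself for A, the same bijection shows that E(a, b) is Galois.

    E(a, b) is built on the free module with basis x^i y^j rather than as a quotient, so that its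
    rank and faithful flatness are immediate. Once A is known to have such a basis, all remaining
    isomorphisms are obtained from monomial bases, which survive base change. *)

Lemma exprD_sqr0 (S : comPzRingType) (s e : S) n : e * e = 0 ->
  (s + e) ^+ n.+1 = s ^+ n.+1 + s ^+ n * e *+ n.+1.
Proof.
move=> e2; elim: n => [|n IHn]; first by rewrite !expr1 expr0 mul1r.
have -> : (s + e) ^+ n.+2 =
    s ^+ n.+2 + s ^+ n.+1 * e *+ n.+2 + s ^+ n * (e * e) *+ n.+1.
  rewrite exprS IHn -!(mulr_natr (_ * _)) [n.+2%:R]mulrSr !(exprS s).
  by move: (s ^+ n) (n.+1%:R) => p m; ring.
by rewrite e2 mulr0 mul0rn addr0.
Qed.

Section SquareZeroRoots.
Variables (S S' : comPzRingType) (p : {rmorphism S -> S'}).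
Hypothesis p_sqr0 : forall x y, p x = 0 -> p y = 0 -> x * y = 0.
Variables (n : nat) (a a' u : S).
Hypotheses (aV : a * a' = 1) (nV : u * n.+1%:R = 1).

(** One Newton step suffices, because the error lies in the kernel of [p] and hence has square
    zero. *)
Lemma lift_root s : p s ^+ n.+1 = p a ->
  exists2 t, t ^+ n.+1 = a & p t = p s.
Proof.
move=> ps; pose e := s ^+ n.+1 - a.
have pe : p e = 0 by rewrite rmorphB rmorphXn ps subrr.
have ee : e * e = 0 by apply: p_sqr0.
(* The Newton correction -e / (N s^n): [u] inverts N, and [s * a'] inverts s^n up to the kernel
   since s^N = a + e. *)
pose d := - (e * u * s * a').
have pd : p d = 0 by rewrite rmorphN !rmorphM pe !mul0r oppr0.
exists (s + d); last by rewrite rmorphD pd addr0.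
have sE : s ^+ n.+1 = a + e by rewrite /e addrC subrK.
have -> : (s + d) ^+ n.+1 = s ^+ n.+1 + s ^+ n * d *+ n.+1.
  by apply: exprD_sqr0; apply: p_sqr0.
have -> : s ^+ n * d *+ n.+1 = - (s ^+ n.+1 * e * a' * (u * n.+1%:R)).
  by rewrite /d -mulr_natr exprS; move: (s ^+ n) (n.+1%:R) => t m; ring.
rewrite nV mulr1 sE; have -> : (a + e) * e * a' = e * (a * a') + e * e * a' by ring.
by rewrite aV ee; ring.
Qed.

(** The difference d of the two roots has square zero, so N t^n d = 0; and N t^n is a unit because
    t^N = a is one. *)
Lemma lift_root_unique s t : s ^+ n.+1 = a -> t ^+ n.+1 = a -> p s = p t -> s = t.
Proof.
move=> sa ta pst; pose d := s - t.
have pd : p d = 0 by rewrite rmorphB pst subrr.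
have dd : d * d = 0 by apply: p_sqr0.
have: s ^+ n.+1 = t ^+ n.+1 + t ^+ n * d *+ n.+1.
  by rewrite -exprD_sqr0 // addrC subrK.
rewrite sa ta => /esym/(canRL (addKr _)); rewrite addNr => td0.
apply/eqP; rewrite -subr_eq0 -/d.
have -> : d = t ^+ n * d *+ n.+1 * (t * a' * u).
  have -> : t ^+ n * d *+ n.+1 * (t * a' * u) = t ^+ n.+1 * a' * (u * n.+1%:R) * d.
    by rewrite -mulr_natr exprS; move: (t ^+ n) (n.+1%:R) => r m; ring.
  by rewrite ta aV nV !mul1r.
by rewrite td0 mul0r.
Qed.

End SquareZeroRoots.

Section PolyEval.
Variables (C : comNzRingType) (S : comPzRingType) (g : {rmorphism C -> S}) (s : S).

(* Horner evaluation through g; {poly S} does not exist when S may be trivial. *)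
Definition eval_via (q : {poly C}) : S := \sum_(i < size q) g q`_i * s ^+ i.

Lemma eval_via_widen (q : {poly C}) m : (size q <= m)%N ->
  eval_via q = \sum_(i < m) g q`_i * s ^+ i.
Proof.
move=> qm; rewrite /eval_via (big_ord_widen _ (fun i => g q`_i * s ^+ i) qm).
rewrite big_mkcond; apply: eq_bigr => i _; case: ltnP => // /(nth_default 0) ->.
by rewrite rmorph0 mul0r.
Qed.

Lemma eval_viaB (q r : {poly C}) : eval_via (q - r) = eval_via q - eval_via r.
Proof.
pose m := maxn (size q) (size r).
have qm : (size q <= m)%N by rewrite leq_maxl.
have rm : (size r <= m)%N by rewrite leq_maxr.
have dm : (size (q - r)%R <= m)%N.
  by rewrite (leq_trans (size_polyD _ _)) // size_polyN.
rewrite !(@eval_via_widen _ m) // -sumrB; apply: eq_bigr => i _.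
by rewrite coefB rmorphB mulrBl.
Qed.

HB.instance Definition _ := GRing.isZmodMorphism.Build _ _ eval_via eval_viaB.

Lemma eval_viaC c : eval_via c%:P = g c.
Proof.
by rewrite (@eval_via_widen _ 1) ?size_polyC_leq1 // big_ord1 coefC mulr1.
Qed.

Lemma eval_viaMX q : eval_via (q * 'X) = eval_via q * s.
Proof.
rewrite (@eval_via_widen _ (size q).+1); last first.
  by rewrite (leq_trans (size_polyMleq _ _)) // size_polyX addn2.
rewrite big_ord_recl coefMX rmorph0 mul0r add0r /eval_via mulr_suml.
by apply: eq_bigr => i _; rewrite coefMX /= exprSr mulrA.
Qed.

Lemma eval_viaM : monoid_morphism eval_via.
Proof.
split=> [|q r]; first by rewrite -polyC1 eval_viaC rmorph1.
elim/poly_ind: q => [|q c IHq]; first by rewrite mul0r raddf0 mul0r.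
rewrite mulrDl !raddfD mulrDl -mulrA (mulrC 'X) mulrA /= !eval_viaMX IHq mulrAC.
congr (_ + _); rewrite eval_viaC mul_polyC.
rewrite (@eval_via_widen _ (size r)) ?size_scale_leq // mulr_sumr.
by apply: eq_bigr => i _; rewrite coefZ rmorphM mulrA.
Qed.

HB.instance Definition _ := GRing.isMonoidMorphism.Build _ _ eval_via eval_viaM.

Lemma eval_viaX : eval_via 'X = s.
Proof. by rewrite -['X]mul1r eval_viaMX rmorph1 mul1r. Qed.

End PolyEval.

Section RootAdjunction.
Import Pdiv.CommonRing Pdiv.RingMonic.
Variables (C : comNzRingType) (n : nat) (a : C).
Let h : {poly C} := 'X^(n.+1) - a%:P.
Let D : comNzRingType := {poly %/ h}.
Let pr : {rmorphism {poly C} -> D} := in_qpoly h.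
Let i : {rmorphism C -> D} := qpolyC h.
Let z : D := pr 'X.

Let size_h : size h = n.+2.
Proof.
by rewrite size_polyDl size_polyXn // size_polyN (leq_ltn_trans (size_polyC_leq1 _)).
Qed.

(** The ring [{poly %/ h}] reduces modulo [mk_monic h], which is [h] itself only when [h] is monic
    and nonconstant. *)
Let mk_h : mk_monic h = h.
Proof.
rewrite /mk_monic size_h monicE lead_coefDl ?lead_coefXn ?eqxx //.
by rewrite size_polyN size_polyXn (leq_ltn_trans (size_polyC_leq1 _)).
Qed.

Let h_monic : h \is monic.
Proof. by rewrite -mk_h monic_mk_monic. Qed.

Let prK (x : D) : pr (val x) = x.
Proof. by apply: val_inj; rewrite /= rmodp_small // size_mk_monic. Qed.

Let prC c : pr c%:P = i c.
Proof.
apply: val_inj; rewrite /= mk_h rmodp_small // size_h.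
exact: leq_ltn_trans (size_polyC_leq1 _) _.
Qed.

Let pr_eq0 p : pr p = 0 <-> exists q, p = q * h.
Proof.
split=> [p0|[q ->]].
  apply/rdvdpP => //; apply/eqP; rewrite -[in rmodp _ _]mk_h.
  exact: (congr1 val p0).
by apply: val_inj; rewrite /= mk_h rmodp_mull.
Qed.

Let z_root : z ^+ n.+1 = i a.
Proof.
apply/eqP; rewrite -subr_eq0 -prC -rmorphXn -rmorphB; apply/eqP/pr_eq0.
by exists 1; rewrite mul1r.
Qed.

Let i_finite : finite_morphism i.
Proof.
exists (mkseq (fun j => z ^+ j) n.+1) => x; exists (fun j => (val x)`_j).
rewrite size_mkseq -[LHS]prK -{1}[val x]coefK poly_def.
have sx : (size (val x) <= n.+1)%N.
  by rewrite -ltnS; apply: (leq_trans (size_mk_monic x)); rewrite mk_h size_h.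
rewrite (big_ord_widen _ (fun i => (val x)`_i *: 'X^i) sx) rmorph_sum.
rewrite big_mkcond; apply: eq_bigr => j _ /=; rewrite nth_mkseq //.
case: ltnP => [_|/(nth_default 0) ->]; last by rewrite rmorph0 mul0r.
by rewrite -mul_polyC rmorphM rmorphXn prC.
Qed.

Let i_presented : finitely_presented i.
Proof.
(* Finite presentation is stated with [{mpoly C[1]}]; [psi] and [chi] are inverse isomorphisms that
   transport the presentation of [D] by [h]. *)
pose psi : {rmorphism {mpoly C[1]} -> {poly C}} := mmap polyC (fun=> 'X).
pose chi : {rmorphism {poly C} -> {mpoly C[1]}} :=
  eval_via (@mpolyC 1 C) 'X_ord0.
have chiK p : chi (psi p) = p.
  elim/mpolyind: p => [|c m p _ _ IHp]; first by rewrite !rmorph0.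
  rewrite !rmorphD IHp -mul_mpolyC !rmorphM /= mmapC eval_viaC mmapX.
  congr (_ * _ + _).
  by rewrite /mmap1 big_ord1 rmorphXn /= eval_viaX [RHS]mpolyXE_id big_ord1.
have psiK p : psi (chi p) = p.
  elim/poly_ind: p => [|r c IHr]; first by rewrite !rmorph0.
  rewrite !rmorphD !rmorphM IHr /= eval_viaC eval_viaX mmapC mmapX mmap1U //.
exists 1, (pr \o psi), [:: chi h]; split=> [c|x|p] /=.
- by rewrite mmapC prC.
- by exists (chi (val x)); rewrite psiK prK.
split=> [/pr_eq0[q pq]|[c ->]].
  by exists (fun=> chi q); rewrite big_ord1 /= -rmorphM -pq chiK.
by rewrite big_ord1 /= rmorphM psiK; apply/pr_eq0; exists (psi (c 0%N)).
Qed.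

Variables a' u : C.
Hypotheses (aV : a * a' = 1) (nV : u * n.+1%:R = 1).

(** A lift is determined by the image of [z], which has to be an N-th root of [g a] above [f z]; the
    lemmas on square-zero kernels provide exactly one. *)
Let i_formally_etale : formally_etale i.
Proof.
move=> S S' p g f p_surj p_sqr0 fi.
have gaV : g a * g a' = 1 by rewrite -rmorphM aV rmorph1.
have gnV : g u * n.+1%:R = 1 by rewrite -(rmorph_nat g) -rmorphM nV rmorph1.
have [s0 s0z] := p_surj (f z).
have [s s_root ps] : exists2 s, s ^+ n.+1 = g a & p s = p s0.
  apply: (lift_root p_sqr0 gaV gnV).
  by rewrite s0z -rmorphXn z_root; exact: fi.
pose l x := eval_via g s (val (x : D)).
(* [l] evaluates the reduced representative; as [s] is a root of [h], any representative gives the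
   same value, which makes [l] a ring morphism. *)
have lpr q : l (pr q) = eval_via g s q.
  have [r rE] : exists r, val (pr q) - q = r * h.
    by apply/pr_eq0; rewrite rmorphB prK subrr.
  apply/eqP; rewrite -subr_eq0 -rmorphB rE rmorphM rmorphB /= rmorphXn /=.
  by rewrite eval_viaX eval_viaC s_root subrr mulr0.
have lB : zmod_morphism l.
  by move=> x y; rewrite -[x]prK -[y]prK -rmorphB !lpr rmorphB.
have lM : monoid_morphism l.
  split=> [|x y]; first by rewrite -(rmorph1 pr) lpr rmorph1.
  by rewrite -[x]prK -[y]prK -rmorphM !lpr rmorphM.
pose lB' := GRing.isZmodMorphism.Build _ _ l lB.
pose lM' := GRing.isMonoidMorphism.Build _ _ l lM.
pose L : {rmorphism D -> S} := HB.pack l lB' lM'.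
have ext (R' : comPzRingType) (l1 l2 : {rmorphism D -> R'}) :
    l1 \o i =1 l2 \o i -> l1 z = l2 z -> l1 =1 l2.
  move=> l12 lz x; rewrite -[x]prK; elim/poly_ind: (val x) => [|q c IHq].
    by rewrite !rmorph0.
  by rewrite !rmorphD !rmorphM IHq -/z lz prC; congr (_ + _); apply: l12.
exists L; first split.
- by move=> c /=; rewrite -prC lpr eval_viaC.
- apply: (ext _ (p \o L) f) => [c|] /=.
    by rewrite -prC lpr eval_viaC prC; exact/esym/fi.
  by rewrite lpr eval_viaX ps s0z.
move=> l' l'i pl'; apply: ext => [c|].
  by rewrite l'i /= -prC lpr eval_viaC.
apply: (@lift_root_unique _ _ p p_sqr0 n (g a) (g a') (g u)) => //.
- by rewrite -rmorphXn z_root; exact: l'i.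
- by rewrite -rmorphXn z_root /= -prC lpr eval_viaC.
- by have := pl' z => /= ->; rewrite lpr eval_viaX ps s0z.
Qed.

Lemma root_adjunction :
  exists (D : comNzRingType) (i : {rmorphism C -> D}) (z z' : D),
  [/\ finite_etale i, z ^+ n.+1 = i a & z * z' = 1].
Proof.
exists D, i, z, (z ^+ n * i a'); split=> //.
by rewrite mulrA -exprS z_root -rmorphM aV rmorph1.
Qed.

End RootAdjunction.

(** * The q-binomial formula at a root of unity *)

Section QBinomial.
Variables (k : fieldType) (q : k).

(** Gaussian binomials through the q-Pascal rule: quotients of q-factorials would read 0/0 at a root
    of unity. *)
Fixpoint qbin n j : k :=
  match n, j with
  | _, O => 1
  | O, S _ => 0
  | S n', S j' => qbin n' j' + q ^+ j * qbin n' j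
  end.

Lemma qbin0 n : qbin n 0 = 1. Proof. by case: n. Qed.

Lemma qbinS n j : qbin n.+1 j.+1 = qbin n j + q ^+ j.+1 * qbin n j.+1.
Proof. by []. Qed.

Lemma qbin_small n j : (n < j)%N -> qbin n j = 0.
Proof.
elim: n j => [|n IHn] [|j] // nj.
by rewrite qbinS !IHn ?mulr0 ?addr0 // ltnW.
Qed.

Lemma qbinn n : qbin n n = 1.
Proof. by elim: n => // n IHn; rewrite qbinS IHn qbin_small // mulr0 addr0. Qed.

(** The q-analogue of (j+1) C(n+1, j+1) = (n+1) C(n, j), both sides multiplied by q - 1. For n+1 = N
    the right side vanishes while q^(j+1) - 1 is nonzero when j+1 < N, which kills the inner
    coefficients. *)
Lemma qbin_absorb n j :
  qbin n.+1 j.+1 * (q ^+ j.+1 - 1) = (q ^+ n.+1 - 1) * qbin n j.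
Proof.
elim: n j => [|n IHn] j.
  case: j => [|j]; first by rewrite /= !mulr0 addr0 mulrC.
  by rewrite qbin_small // mulr0 mul0r.
rewrite qbinS mulrDl -mulrA IHn mulrC.
have -> : q ^+ j.+1 - 1 = (q - 1) + q * (q ^+ j - 1) by rewrite exprS; ring.
case: j => [|j]; first by rewrite !qbin0 !exprS; ring.
rewrite mulrDl -mulrA [(_ ^+ _ - 1) * _]mulrC IHn.
by rewrite [qbin n.+1 j.+1]qbinS !exprS; ring.
Qed.

Lemma qbin_prim N j : N.-primitive_root q -> (0 < j < N)%N -> qbin N j = 0.
Proof.
move=> qN; case: N qN => [|N] qN; case: j => [|j] // /andP[_ jN].
have /eqP := qbin_absorb N j; rewrite (prim_expr_order qN) subrr mul0r mulf_eq0.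
case/orP=> [/eqP //|]; rewrite subr_eq0 -(expr0 q) (eq_prim_root_expr qN).
by rewrite mod0n modn_small.
Qed.

Variables (B : assocAlg k) (U V : B).
Hypothesis VU : V * U = q *: (U * V).

Lemma qcomm_exprr n : V * U ^+ n = q ^+ n *: (U ^+ n * V).
Proof.
elim: n => [|n IHn]; first by rewrite expr0 mulr1 mul1r scale1r.
rewrite !exprS mulrA VU -alg_scaleAl -mulrA IHn -alg_scaleAr scalerA.
by rewrite mulrA.
Qed.

Lemma qcomm_expr m n : V ^+ m * U ^+ n = q ^+ (m * n) *: (U ^+ n * V ^+ m).
Proof.
elim: m => [|m IHm]; first by rewrite expr0 mulr1 mul1r scale1r.
rewrite exprS -mulrA IHm -alg_scaleAr mulrA qcomm_exprr -alg_scaleAl scalerA.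
by rewrite -exprD -mulrA -exprS mulSn addnC.
Qed.

Lemma qbinomial n :
  (U + V) ^+ n = \sum_(j < n.+1) qbin n j *: (U ^+ j * V ^+ (n - j)).
Proof.
elim: n => [|n IHn]; first by rewrite big_ord1 /= !expr0 mulr1 scale1r.
rewrite exprS IHn mulrDl !mulr_sumr.
have -> : \sum_(i < n.+1) V * (qbin n i *: (U ^+ i * V ^+ (n - i))) =
    \sum_(i < n.+2) (q ^+ i * qbin n i) *: (U ^+ i * V ^+ (n.+1 - i)).
  rewrite [RHS]big_ord_recr /= qbin_small // mulr0 scale0r addr0.
  apply: eq_bigr => i _; rewrite -alg_scaleAr mulrA qcomm_exprr -alg_scaleAl.
  by rewrite scalerA mulrC -mulrA -exprS subSn // -ltnS.
rewrite [X in _ + X]big_ord_recl [RHS]big_ord_recl addrCA.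
congr (_ + _); first by rewrite !qbin0 mulr1.
rewrite -big_split; apply: eq_bigr => i _.
rewrite lift0 qbinS subSS scalerDl; congr (_ + _).
by rewrite -alg_scaleAr mulrA -exprS.
Qed.

(** N-th powers are additive on q-commuting pairs. This gives both the coinvariance of y^N and the
    relation Y^N = 0 for the translation map. *)
Lemma qbinomial_prim N :
  N.-primitive_root q -> (U + V) ^+ N = U ^+ N + V ^+ N.
Proof.
move=> qN; rewrite qbinomial big_ord_recr /= qbinn scale1r subnn expr0 mulr1.
case: N qN => [|N] qN; first by have := prim_order_gt0 qN.
rewrite big_ord_recl /= scale1r expr0 mul1r addrC big1 ?addr0 // => i _.
by rewrite -[X in X *: _]/(qbin N.+1 i.+1) qbin_prim ?scale0r //= ltnS.
Qed.

Lemma qcomm_exprM n : (U * V) ^+ n = q ^+ 'C(n, 2) *: (U ^+ n * V ^+ n).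
Proof.
elim: n => [|n IHn]; first by rewrite !expr0 mulr1 scale1r.
rewrite exprSr IHn -alg_scaleAl -mulrA [V ^+ n * _]mulrA -{2}[U]expr1.
rewrite qcomm_expr muln1 -alg_scaleAl -alg_scaleAr scalerA -exprD.
by rewrite binS bin1 -!mulrA -exprSr mulrA -exprSr.
Qed.

End QBinomial.

(** Compare constant terms in X^N - 1 = prod (X - q^i). The sign lets two N-th powers cancel in
    [translation_relations]. *)
Lemma prim_root_expr_bin2 (k : fieldType) (q : k) N :
  N.-primitive_root q -> (-1) ^+ N * q ^+ 'C(N, 2) = -1.
Proof.
move=> qN; have /(congr1 (fun p => p.[0])) := factor_Xn_sub_1 qN.
rewrite !hornerE expr0n (gtn_eqF (prim_order_gt0 qN)) sub0r => E.
rewrite -[RHS]E horner_prod -triangular_sum -prodrXr.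
rewrite [RHS](eq_bigr (fun i => -1 * q ^+ i)) => [|i _].
  by rewrite big_split prodr_const_nat subn0.
by rewrite !hornerE mulN1r.
Qed.

(** * The algebras x^N = a, y^N = b, yx = wxy *)

Section Model.
Variables (R : comNzRingType) (n : nat) (w a b : R).
Local Notation N := n.+1.
Local Notation I := ('I_N * 'I_N)%type.
Local Notation M := {ffun I -> R^o}.

(** The monomial x^i y^j for arbitrary exponents, already reduced by x^N = a and y^N = b, so that
    products need no case distinction when exponents exceed n. *)
Definition mono (i j : nat) : M :=
  [ffun p : I => if p == (inZp i, inZp j) then a ^+ (i %/ N) * b ^+ (j %/ N) else 0].

Definition model_mul (f g : M) : M :=
  \sum_(p : I) \sum_(r : I)
    (f p * g r * w ^+ (p.2 * r.1)) *: mono (p.1 + r.1) (p.2 + r.2).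

Lemma mono_mulnl m i j : mono (i + m * N) j = a ^+ m *: mono i j.
Proof.
apply/ffunP=> p; rewrite !ffunE.
have -> : inZp (i + m * N) = inZp i :> 'I_N by apply: val_inj; rewrite /= addnC modnMDl.
case: eqP => _; last by rewrite scaler0.
by rewrite addnC divnMDl // exprD -mulrA.
Qed.

Lemma mono_mulnr m i j : mono i (j + m * N) = b ^+ m *: mono i j.
Proof.
apply/ffunP=> p; rewrite !ffunE.
have -> : inZp (j + m * N) = inZp j :> 'I_N by apply: val_inj; rewrite /= addnC modnMDl.
case: eqP => _; last by rewrite scaler0.
by rewrite addnC divnMDl // exprD /GRing.scale /=; ring.
Qed.

Lemma mono_ord (p p' : I) : mono p.1 p.2 p' = (p' == p)%:R.
Proof.
rewrite ffunE !valZpK !divn_small // mulr1.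
by case: p => p1 p2; case: eqP.
Qed.

Lemma model_decomp (f : M) : f = \sum_(p : I) f p *: mono p.1 p.2.
Proof.
apply/ffunP=> r; rewrite sum_ffunE (bigD1 r) //= ffunE.
rewrite mono_ord eqxx [_ *: _]mulr1 big1 ?addr0 // => p pr.
by rewrite ffunE mono_ord eq_sym (negPf pr) scaler0.
Qed.

Lemma model_ind (P : M -> Prop) :
    (forall r i j, P (r *: mono i j)) -> (forall f g, P f -> P g -> P (f + g)) ->
  forall f, P f.
Proof.
move=> PZ PD f; rewrite [f]model_decomp.
apply: big_ind => //; first by rewrite -(scale0r (mono 0 0)).
Qed.

Lemma model_mulDl f g h : model_mul (f + g) h = model_mul f h + model_mul g h.
Proof.
rewrite /model_mul -big_split; apply: eq_bigr => p _.
rewrite -big_split; apply: eq_bigr => r _ /=.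
by rewrite ffunE !mulrDl scalerDl.
Qed.

Lemma model_mulDr f g h : model_mul f (g + h) = model_mul f g + model_mul f h.
Proof.
rewrite /model_mul -big_split; apply: eq_bigr => p _.
rewrite -big_split; apply: eq_bigr => r _ /=.
by rewrite ffunE mulrDr mulrDl scalerDl.
Qed.

Lemma model_mulZl r f g : model_mul (r *: f) g = r *: model_mul f g.
Proof.
rewrite /model_mul scaler_sumr; apply: eq_bigr => p _.
rewrite scaler_sumr; apply: eq_bigr => s _ /=.
by rewrite ffunE scalerA !mulrA.
Qed.

Lemma model_mulZr r f g : model_mul f (r *: g) = r *: model_mul f g.
Proof.
rewrite /model_mul scaler_sumr; apply: eq_bigr => p _.
rewrite scaler_sumr; apply: eq_bigr => s _ /=.
by rewrite ffunE scalerA !mulrA [f p * r]mulrC.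
Qed.

Hypothesis wN : w ^+ N = 1.

(** Reducing exponents must not alter the reordering factor; this holds because w^(j i') depends
    only on residues modulo N. With all exponents allowed, associativity becomes an identity between
    exponents. *)
Lemma model_mul_mono i j i' j' :
  model_mul (mono i j) (mono i' j') = w ^+ (j * i') *: mono (i + i') (j + j').
Proof.
have small (p r : I) : model_mul (mono p.1 p.2) (mono r.1 r.2) =
    w ^+ (p.2 * r.1) *: mono (p.1 + r.1) (p.2 + r.2).
  rewrite /model_mul (bigD1 p) //= [X in _ + X]big1 ?addr0 => [|s sp]; last first.
    by apply: big1 => t _; rewrite mono_ord (negPf sp) !mul0r scale0r.
  rewrite (bigD1 r) //= [X in _ + X]big1 ?addr0 => [|s sr].
    by rewrite !mono_ord !eqxx !mul1r.
  by rewrite !mono_ord (negPf sr) mulr0 mul0r scale0r.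
have red i0 j0 : mono i0 j0 = (a ^+ (i0 %/ N) * b ^+ (j0 %/ N)) *:
    mono (inZp i0 : 'I_N) (inZp j0 : 'I_N).
  rewrite {1}(divn_eq i0 N) {1}(divn_eq j0 N) !(addnC (_ * N)%N).
  by rewrite mono_mulnl mono_mulnr scalerA.
rewrite (red i j) (red i' j') model_mulZl model_mulZr.
rewrite (small (inZp i, inZp j) (inZp i', inZp j')) /= !scalerA.
rewrite [in RHS](divn_eq i N) [in RHS](divn_eq i' N).
rewrite [in RHS](divn_eq j N) [in RHS](divn_eq j' N).
have -> : (i %/ N * N + i %% N + (i' %/ N * N + i' %% N))%N =
          (i %% N + i' %% N + (i %/ N + i' %/ N) * N)%N by rewrite mulnDl; ring.
have -> : (j %/ N * N + j %% N + (j' %/ N * N + j' %% N))%N =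
          (j %% N + j' %% N + (j %/ N + j' %/ N) * N)%N by rewrite mulnDl; ring.
rewrite mono_mulnl mono_mulnr !scalerA; congr (_ *: _).
have -> : w ^+ ((j %/ N * N + j %% N) * (i' %/ N * N + i' %% N)) =
    w ^+ (j %% N * (i' %% N)).
  rewrite -(expr_mod _ wN) -modnMm !modnMDl !modn_mod -[RHS](expr_mod _ wN).
  by rewrite modnMm.
by rewrite !exprD; ring.
Qed.

Lemma model_mulA : associative model_mul.
Proof.
move=> f g h; elim/model_ind: f => [r i j|f f' IHf IHf']; last first.
  by rewrite !model_mulDl IHf IHf'.
elim/model_ind: g => [r' i' j'|g g' IHg IHg']; last first.
  by rewrite model_mulDl !model_mulDr model_mulDl IHg IHg'.
elim/model_ind: h => [r'' i'' j''|h h' IHh IHh']; last first.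
  by rewrite !model_mulDr IHh IHh'.
rewrite !(model_mulZl, model_mulZr, model_mul_mono) !scalerA !addnA.
congr (_ *: _); rewrite !mulnDr !mulnDl !exprD; ring.
Qed.

Lemma model_mul1l : left_id (mono 0 0) model_mul.
Proof.
elim/model_ind=> [r i j|f g IHf IHg]; last by rewrite model_mulDr IHf IHg.
by rewrite model_mulZr model_mul_mono mul0n expr0 scale1r.
Qed.

Lemma model_mul1r : right_id (mono 0 0) model_mul.
Proof.
elim/model_ind=> [r i j|f g IHf IHg]; last by rewrite model_mulDl IHf IHg.
by rewrite model_mulZl model_mul_mono muln0 expr0 scale1r !addn0.
Qed.

Definition model_alg : assocAlg R :=
  @AssocAlg R M (mono 0 0) model_mul model_mulA model_mul1l model_mul1r
    model_mulDl model_mulDr model_mulZl model_mulZr.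

Definition model_x : model_alg := mono 1 0.
Definition model_y : model_alg := mono 0 1.

Lemma mono_mul i j i' j' : (mono i j : model_alg) * (mono i' j' : model_alg)
  = w ^+ (j * i') *: (mono (i + i') (j + j') : model_alg).
Proof. exact: model_mul_mono. Qed.

Lemma model_xX i : model_x ^+ i = mono i 0.
Proof.
elim: i => // i IHi; rewrite exprS IHi mono_mul mul0n expr0 scale1r.
by rewrite add1n.
Qed.

Lemma model_yX j : model_y ^+ j = mono 0 j.
Proof.
elim: j => // j IHj; rewrite exprS IHj mono_mul muln0 expr0 scale1r.
by rewrite add1n.
Qed.

Lemma model_monoE i j : model_x ^+ i * model_y ^+ j = mono i j.
Proof. by rewrite model_xX model_yX mono_mul mul0n expr0 scale1r add0n addn0. Qed.

Lemma model_xN : model_x ^+ N = a *: (1 : model_alg).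
Proof. by rewrite model_xX -[N in LHS]add0n -[N in LHS]mul1n mono_mulnl expr1. Qed.

Lemma model_yN : model_y ^+ N = b *: (1 : model_alg).
Proof. by rewrite model_yX -[N in LHS]add0n -[N in LHS]mul1n mono_mulnr expr1. Qed.

Lemma model_yx : model_y * model_x = w *: (model_x * model_y).
Proof.
by rewrite /model_x /model_y !mono_mul muln1 mul0n expr1 expr0 scale1r addn0.
Qed.

Section Eval.
Variables (B : pzRingType) (u : {rmorphism R -> B}) (P Q : B).
Hypotheses (uP : forall r, GRing.comm (u r) P) (uQ : forall r, GRing.comm (u r) Q).
Hypotheses (PN : P ^+ N = u a) (QN : Q ^+ N = u b) (QP : Q * P = u w * (P * Q)).

(** The target is a ring with a map [u] from R whose values commute with [P] and [Q], not an
    R-algebra: it must cover A \ox H, which is available only as a k-algebra. *)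
Definition model_eval (f : M) : B :=
  \sum_(p : I) u (f p) * (P ^+ p.1 * Q ^+ p.2).

Lemma model_evalD f g : model_eval (f + g) = model_eval f + model_eval g.
Proof.
by rewrite -big_split; apply: eq_bigr => p _ /=; rewrite ffunE rmorphD mulrDl.
Qed.

Lemma model_evalZ r f : model_eval (r *: f) = u r * model_eval f.
Proof.
by rewrite mulr_sumr; apply: eq_bigr => p _; rewrite ffunE [RHS]mulrA -rmorphM.
Qed.

Lemma model_eval_mono i j : model_eval (mono i j) = P ^+ i * Q ^+ j.
Proof.
rewrite /model_eval (bigD1 (inZp i, inZp j)) //= ffunE eqxx big1 ?addr0; last first.
  by move=> p /negPf pij; rewrite ffunE pij rmorph0 mul0r.
rewrite [in RHS](divn_eq i N) [in RHS](divn_eq j N) !exprD !(mulnC _ N) !exprM.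
rewrite PN QN -!rmorphXn rmorphM -!mulrA; congr (_ * _).
rewrite !mulrA; congr (_ * _).
by apply/commrX; apply: uP.
Qed.

Let QX r j : GRing.comm (u r) (Q ^+ j). Proof. exact/commrX/uQ. Qed.
Let PX r j : GRing.comm (u r) (P ^+ j). Proof. exact/commrX/uP. Qed.

Let QPX j i : Q ^+ j * P ^+ i = u (w ^+ (j * i)) * (P ^+ i * Q ^+ j).
Proof.
have QPi i' : Q * P ^+ i' = u (w ^+ i') * (P ^+ i' * Q).
  elim: i' => [|i' IHi]; first by rewrite !expr0 rmorph1 mulr1 !mul1r.
  rewrite exprSr mulrA IHi -!mulrA QP !mulrA -[_ * P ^+ i' * u w]mulrA -(PX w i').
  by rewrite exprSr rmorphM !mulrA.
elim: j => [|j IHj]; first by rewrite !expr0 rmorph1 mulr1 !mul1r.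
rewrite exprS -mulrA IHj !mulrA -(uQ (w ^+ _)) -[_ * Q * P ^+ i]mulrA QPi.
by rewrite !mulrA -rmorphM -exprD mulSn addnC -!mulrA.
Qed.

Lemma model_evalM (f g : model_alg) : model_eval (f * g) = model_eval f * model_eval g.
Proof.
elim/model_ind: f => [r i j|f f' IHf IHf']; last first.
  by rewrite mulrDl !model_evalD mulrDl IHf IHf'.
elim/model_ind: g => [r' i' j'|g g' IHg IHg']; last first.
  by rewrite mulrDr !model_evalD mulrDr IHg IHg'.
rewrite -alg_scaleAl -alg_scaleAr mono_mul !model_evalZ !model_eval_mono.
rewrite -[RHS]mulrA; congr (_ * _).
rewrite [RHS]mulrA -(mulrA (P ^+ i) (Q ^+ j)) -QX [P ^+ i * _]mulrA -PX -!mulrA.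
congr (_ * _); rewrite [Q ^+ j * (_ * _)]mulrA QPX !exprD.
by rewrite [RHS]mulrA [P ^+ i * (_ * _)]mulrA -PX -!mulrA.
Qed.

Lemma model_eval1 : model_eval (1 : model_alg) = 1.
Proof. by rewrite model_eval_mono !expr0 mulr1. Qed.

Lemma model_evalx : model_eval model_x = P.
Proof. by rewrite model_eval_mono mulr1. Qed.

Lemma model_evaly : model_eval model_y = Q.
Proof. by rewrite model_eval_mono mul1r. Qed.

End Eval.
End Model.

(** * Morphisms of tensor products *)

Section Linear.
Variables (R : pzRingType) (M M' : lmodType R) (f : M -> M').
Hypothesis f_lin : linear f.

Lemma linear_fun0 : f 0 = 0.
Proof. by have := f_lin (-1) 0 0; rewrite scaler0 addr0 scaleN1r addNr. Qed.

Lemma linear_funD x y : f (x + y) = f x + f y.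
Proof. by rewrite -[x in LHS]scale1r f_lin scale1r. Qed.

Lemma linear_funZ r x : f (r *: x) = r *: f x.
Proof. by rewrite -[_ *: x]addr0 f_lin linear_fun0 addr0. Qed.

Lemma linear_fun_sum I (s : seq I) (F : I -> M) :
  f (\sum_(i <- s) F i) = \sum_(i <- s) f (F i).
Proof. exact: (big_morph f linear_funD linear_fun0). Qed.

End Linear.

Lemma monoid_morphismX (A B : pzRingType) (f : A -> B) (f_mon : monoid_morphism f)
  x n : f (x ^+ n) = f x ^+ n.
Proof. by elim: n => [|n IHn]; rewrite ?f_mon.1 // !exprS f_mon.2 IHn. Qed.

Section TensorMorphism.
Variable R : comPzRingType.

Lemma tensor_mulM (A B : assocAlg R) (a a' : A) (b b' : B) :
  (a \ox b : tensor_alg A B) * (a' \ox b' : tensor_alg A B) = (a * a') \ox (b * b').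
Proof. exact: tensor_mulE. Qed.

Lemma tensor_mulX (A B : assocAlg R) (a : A) (b : B) n :
  (a \ox b : tensor_alg A B) ^+ n = (a ^+ n) \ox (b ^+ n).
Proof. by elim: n => // n IHn; rewrite !exprS IHn tensor_mulM. Qed.

Lemma tlift_linear (M N P : lmodType R) (h : M -> N -> P) :
    balanced h -> (forall r m n, h (r *: m) n = r *: h m n) ->
  linear (tlift h : tensor M N -> P).
Proof.
move=> h_bal hZ r s t; rewrite tliftD //; congr (_ + _).
elim/tensor_ind: s => [m n|s s' IHs IHs']; first by rewrite tensorZl !tliftE.
by rewrite scalerDr !tliftD // IHs IHs' scalerDr.
Qed.

Lemma tlift_monoid_morphism (A B : assocAlg R) (D : pzRingType) (h : A -> B -> D) :
    balanced h -> h 1 1 = 1 ->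
    (forall a b a' b', h (a * a') (b * b') = h a b * h a' b') ->
  monoid_morphism (tlift h : tensor_alg A B -> D).
Proof.
move=> h_bal h1 hM; split=> [|s t]; first by rewrite [LHS]tliftE.
elim/tensor_ind: s => [a b|s s' IHs IHs']; last first.
  by rewrite mulrDl !tliftD // IHs IHs' mulrDl.
elim/tensor_ind: t => [a' b'|t t' IHt IHt']; last first.
  by rewrite mulrDr !tliftD // IHt IHt' mulrDr.
by rewrite tensor_mulM !tliftE.
Qed.

Lemma tmap_balanced (M M' N N' : lmodType R) (f : M -> M') (g : N -> N') :
  linear f -> linear g -> balanced (fun m n => f m \ox g n).
Proof.
move=> fl gl; split=> [m m' n|m n n'|r m n].
- by rewrite (linear_funD fl) tmulDl.
- by rewrite (linear_funD gl) tmulDr.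
- by rewrite (linear_funZ fl) (linear_funZ gl) tmulZ.
Qed.

Lemma tmap_tmul (M M' N N' : lmodType R) (f : M -> M') (g : N -> N') m n :
  linear f -> linear g -> tmap f g (m \ox n) = f m \ox g n.
Proof. by move=> fl gl; rewrite /tmap tliftE //; exact: tmap_balanced. Qed.

Lemma tmap_linear (M M' N N' : lmodType R) (f : M -> M') (g : N -> N') :
  linear f -> linear g -> linear (tmap f g).
Proof.
move=> fl gl; apply: tlift_linear => [|r m n]; first exact: tmap_balanced.
by rewrite (linear_funZ fl) tensorZl.
Qed.

Lemma id_linear (M : lmodType R) : linear (@id M). Proof. by []. Qed.

Lemma tmap_algebra_morphism (A A' B B' : assocAlg R) (f : A -> A') (g : B -> B') :
    algebra_morphism f -> algebra_morphism g ->
  algebra_morphism (tmap f g : tensor_alg A B -> tensor_alg A' B').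
Proof.
case=> fl [f1 fM] [gl [g1 gM]]; split; first exact: tmap_linear.
apply: tlift_monoid_morphism; first exact: tmap_balanced.
  by rewrite f1 g1.
by move=> a b a' b'; rewrite fM gM tensor_mulM.
Qed.

Lemma id_algebra_morphism (A : assocAlg R) : algebra_morphism (@id A).
Proof. by []. Qed.

Lemma comp_linear (M N P : lmodType R) (g : N -> P) (f : M -> N) :
  linear g -> linear f -> linear (g \o f).
Proof. by move=> gl fl r x y /=; rewrite fl gl. Qed.

Lemma comp_algebra_morphism (A B D : assocAlg R) (g : B -> D) (f : A -> B) :
  algebra_morphism g -> algebra_morphism f -> algebra_morphism (g \o f).
Proof.
case=> gl [g1 gM] [fl [f1 fM]]; split; first exact: comp_linear.
by split=> [|x y] /=; rewrite ?f1 ?g1 // fM gM.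
Qed.

Lemma tmap_comp (M M' M'' N N' N'' : lmodType R) (f' : M' -> M'') (f : M -> M')
    (g' : N' -> N'') (g : N -> N') t :
    linear f -> linear f' -> linear g -> linear g' ->
  tmap f' g' (tmap f g t) = tmap (f' \o f) (g' \o g) t.
Proof.
move=> fl fl' gl gl'; elim/tensor_ind: t => [m n|s t IHs IHt].
  by rewrite !tmap_tmul //; exact: comp_linear.
rewrite !(linear_funD (tmap_linear _ _)) ?IHs ?IHt //; exact: comp_linear.
Qed.

Lemma tassoc_balanced1 (M N P : lmodType R) (p : P) :
  balanced (fun (m : M) (n : N) => m \ox (n \ox p)).
Proof.
split=> [m m' n|m n n'|r m n]; first by rewrite tmulDl.
  by rewrite tmulDl tmulDr.
by rewrite tmulZ tensorZl.
Qed.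

Lemma tassoc_balanced2 (M N P : lmodType R) :
  balanced (fun (t : tensor M N) (p : P) => tlift (fun m n => m \ox (n \ox p)) t).
Proof.
have bal1 := @tassoc_balanced1 M N P.
split=> [s t p|t p p'|r t p]; first by rewrite tliftD.
  elim/tensor_ind: t => [m n|s t IHs IHt].
    by rewrite !tliftE // !tmulDr.
  by rewrite !tliftD // IHs IHt addrACA.
elim/tensor_ind: t => [m n|s t IHs IHt].
  by rewrite tensorZl !tliftE // tmulZ tensorZl tmulZ.
by rewrite scalerDr !tliftD // IHs IHt.
Qed.

Lemma tassoc_tmul (M N P : lmodType R) (m : M) (n : N) (p : P) :
  tassoc ((m \ox n) \ox p) = m \ox (n \ox p).
Proof.
rewrite /tassoc tliftE ?tliftE //; first exact: tassoc_balanced1.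
exact: tassoc_balanced2.
Qed.

Lemma tassocD (M N P : lmodType R) (s t : tensor (tensor M N) P) :
  tassoc (s + t) = tassoc s + tassoc t.
Proof. exact/tliftD/tassoc_balanced2. Qed.

Lemma tassoc1 (A B D : assocAlg R) :
  tassoc (1 : tensor_alg (tensor_alg A B) D) = (1 : tensor_alg A (tensor_alg B D)).
Proof. exact: tassoc_tmul. Qed.

Lemma tassoc_tensor_mul (A B D : assocAlg R) (s t : tensor_alg (tensor_alg A B) D) :
  tassoc (tensor_mul s t) = tensor_mul (B := tensor_alg B D) (tassoc s) (tassoc t).
Proof.
elim/tensor_ind: s => [ab d|s s' IHs IHs']; last first.
  by rewrite tensor_mulDl !tassocD IHs IHs' tensor_mulDl.
elim/tensor_ind: t => [ab' d'|t t' IHt IHt']; last first.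
  by rewrite tensor_mulDr !tassocD IHt IHt' tensor_mulDr.
elim/tensor_ind: ab => [a b|u u' IHu IHu']; last first.
  by rewrite tmulDl tensor_mulDl !tassocD IHu IHu' tensor_mulDl.
elim/tensor_ind: ab' => [a' b'|u u' IHu IHu']; last first.
  by rewrite tmulDl tensor_mulDr !tassocD IHu IHu' tensor_mulDr.
rewrite tensor_mulE !tassoc_tmul tensor_mulE.
apply: (etrans (congr1 (fun t => tassoc (t \ox _)) (tensor_mulE a a' b b'))).
rewrite tassoc_tmul; congr (_ \ox _).
exact/esym/tensor_mulE.
Qed.

Lemma tassocM (A B D : assocAlg R) (s t : tensor_alg (tensor_alg A B) D) :
  tassoc (s * t) = (tassoc s : tensor_alg A (tensor_alg B D)) * tassoc t.
Proof. exact: tassoc_tensor_mul. Qed.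

End TensorMorphism.

(** * The monomial basis of the Taft algebra *)

Definition coord_basis (R : pzRingType) (M : lmodType R) (I : finType)
    (e : I -> M) (co : I -> M -> R) : Prop :=
  [/\ forall i, linear (co i : M -> R^o),
      forall i j, co i (e j) = (i == j)%:R
    & forall m, m = \sum_i co i m *: e i].

Definition taft_universal (k : fieldType) (N : nat) (q : k) (H : hopfAlgebra k)
    (X Y : H) : Prop :=
  forall (B : assocAlg k) (x y : B), taft_relations N q x y ->
    exists2 f : H -> B, [/\ algebra_morphism f, f X = x & f Y = y]
      & forall g : H -> B, algebra_morphism g -> g X = x -> g Y = y -> g =1 f.

Section TaftBasis.
Variables (k : fieldType) (n : nat) (q : k) (H : hopfAlgebra k).
Local Notation N := n.+1.
Local Notation I := ('I_N * 'I_N)%type.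
Hypothesis qN : q ^+ N = 1.
Variables X Y : H.
Hypothesis H_universal : taft_universal N q X Y.
Hypothesis H_dim : exists f : {linear 'rV[k]_(N ^ 2) -> alg_sort H}, bijective f.

(** The universal property maps H to the model with a = 1, b = 0, sending the monomials to its
    basis. Both spaces have dimension N^2, so this surjection is an isomorphism and the coordinates
    can be pulled back. *)
Lemma taft_basis : exists co,
  coord_basis (fun p : I => X ^+ p.1 * Y ^+ p.2 : H) co.
Proof.
pose MA := model_alg (1 : k) 0 qN.
have [g [[g_lin g_mon] gX gY] _] : exists2 g : H -> MA,
    [/\ algebra_morphism g, g X = model_x 1 0 qN & g Y = model_y 1 0 qN]
    & forall g' : H -> MA, algebra_morphism g' -> g' X = model_x 1 0 qN ->
        g' Y = model_y 1 0 qN -> g' =1 g.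
  apply: H_universal; split.
  - by rewrite model_xN scale1r.
  - by rewrite model_yN scale0r.
  - exact: model_yx.
pose e (p : I) : H := X ^+ p.1 * Y ^+ p.2.
pose s (f : {ffun I -> k^o}) : H := \sum_p f p *: e p.
have ge p : g (e p) = mono n 1 0 p.1 p.2.
  by rewrite g_mon.2 !(monoid_morphismX g_mon) gX gY model_monoE.
have gs f : g (s f) = f.
  rewrite (linear_fun_sum g_lin) [RHS](model_decomp 1 0 f).
  by apply: eq_bigr => p _; rewrite (linear_funZ g_lin) ge.
have [phi phi_bij] := H_dim; have [phiV phiK phiVK] := phi_bij.
(* [psi] is [g] in coordinates, a map between row spaces of equal dimension, so that full rank gives
   injectivity. *)
pose psi (v : 'rV[k]_(N ^ 2)) : 'rV[k]_#|{: I}| :=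
  \row_j (g (phi v) : {ffun I -> k^o}) (enum_val j).
have psi_lin : linear psi.
  move=> r u v; apply/rowP=> j; rewrite !mxE linearP g_lin.
  by rewrite [LHS]ffunE [X in X + _]ffunE.
pose psiL : {linear 'rV[k]_(N ^ 2) -> 'rV[k]_#|{: I}|} :=
  HB.pack psi (GRing.isLinear.Build _ _ _ _ psi psi_lin).
pose A := lin1_mx psiL.
have psi_phiV h j : psi (phiV h) 0 j = (g h : {ffun I -> k^o}) (enum_val j).
  by rewrite mxE phiVK.
have A_full : row_full A.
  apply/row_fullP; exists (\matrix_j phiV (e (enum_val j))).
  apply/row_matrixP=> j; rewrite row_mul rowK mul_rV_lin1 /=.
  apply/rowP=> l; rewrite psi_phiV ge mono_ord !mxE.
  by rewrite (inj_eq enum_val_inj) eq_sym.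
have A_free : row_free A.
  move: A_full; rewrite /row_full /row_free => /eqP->.
  by rewrite card_prod card_ord expnS expn1.
have g_inj h h' : g h = g h' -> h = h'.
  move=> gh; rewrite -[h]phiVK -[h']phiVK; congr (phi _).
  apply: (row_free_inj A_free); rewrite !mul_rV_lin1 /=.
  by apply/rowP=> j; rewrite !psi_phiV gh.
exists (fun p h => (g h : {ffun I -> k^o}) p); split=> [p r h h'|p p'|h].
- by rewrite g_lin [LHS]ffunE [X in X + _]ffunE.
- by rewrite -/(e p') ge mono_ord.
by apply: g_inj; rewrite -[LHS]gs.
Qed.

(** Generation of H by X and Y is read off from the monomial basis. *)
Lemma taft_ind (P : H -> Prop) :
    P 1 -> P X -> P Y -> (forall h h', P h -> P h' -> P (h * h')) ->
    (forall h h', P h -> P h' -> P (h + h')) -> (forall r h, P h -> P (r *: h)) ->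
  forall h, P h.
Proof.
move=> P1 PX PY PM PD PZ h; have [co [_ _ coE]] := taft_basis; rewrite (coE h).
have PXn h' m : P h' -> P (h' ^+ m).
  by move=> Ph'; elim: m => // m IHm; rewrite exprS; apply: PM.
elim/big_ind: _ => // [|p _]; first by rewrite -(scale0r (1 : H)); apply: PZ.
by apply/PZ/PM; apply: PXn.
Qed.

End TaftBasis.

(** * The comodule algebras x^N = a, y^N = b, yx = qxy *)

Section ScalarMap.
Variables (R : comPzRingType) (A : assocAlg R).

Definition scalar_map (r : R) : A := r *: (1 : A).

Lemma scalar_mapB : zmod_morphism scalar_map.
Proof. by move=> r s; rewrite /scalar_map scalerBl. Qed.

Lemma scalar_mapM : monoid_morphism scalar_map.
Proof.
split=> [|r s]; first exact: scale1r.
by rewrite /scalar_map -alg_scaleAl mul1r scalerA.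
Qed.

HB.instance Definition _ := GRing.isZmodMorphism.Build R A scalar_map scalar_mapB.
HB.instance Definition _ := GRing.isMonoidMorphism.Build R A scalar_map scalar_mapM.

Lemma scalar_mapE r (a : A) : scalar_map r * a = r *: a.
Proof. by rewrite /scalar_map -alg_scaleAl mul1r. Qed.

Lemma scalar_map_comm r (a : A) : GRing.comm (scalar_map r) a.
Proof. by rewrite /GRing.comm scalar_mapE /scalar_map -alg_scaleAr mulr1. Qed.

End ScalarMap.

Section Extensions.
Variables (k : fieldType) (H : hopfAlgebra k).
Variables (R : comNzRingType) (phi : {rmorphism k -> R}).

(* The R-algebra structure of A \ox H, which is only a k-algebra. *)
Definition base_map (A : assocAlg R) (r : R) : tensor_alg (restrict phi A) H :=
  (scalar_map A r : restrict phi A) \ox (1 : H).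

Lemma base_mapB A : zmod_morphism (base_map A).
Proof.
move=> r s; rewrite /base_map rmorphB -tmulNl -tmulDl //.
Qed.

Lemma base_mapM A : monoid_morphism (base_map A).
Proof.
split=> [|r s]; first by rewrite /base_map rmorph1.
by rewrite /base_map rmorphM tensor_mulM mulr1.
Qed.

HB.instance Definition _ A :=
  GRing.isZmodMorphism.Build R (tensor_alg (restrict phi A) H) (base_map A)
    (@base_mapB A).
HB.instance Definition _ A :=
  GRing.isMonoidMorphism.Build R (tensor_alg (restrict phi A) H) (base_map A)
    (@base_mapM A).

Lemma base_map_comm A r t : GRing.comm (base_map A r) t.
Proof.
elim/tensor_ind: t => [a h|s t IHs IHt]; last exact: commrD.
rewrite /GRing.comm /base_map !tensor_mulM mulr1 mul1r; congr (_ \ox _).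
exact: (@scalar_map_comm _ A r a).
Qed.

Lemma base_map_phi A c : base_map A (phi c) = c *: (1 : tensor_alg (restrict phi A) H).
Proof. by rewrite [RHS]tensorZl. Qed.

Lemma base_mapE A r (a : restrict phi A) (h : H) :
  base_map A r * (a \ox h) = (r *: (a : A) : restrict phi A) \ox h.
Proof.
by rewrite /base_map tensor_mulM mul1r; congr (_ \ox _); exact: (@scalar_mapE _ A r a).
Qed.

(** The part of [is_extension] on which the computations rely. It is available for models before
    their coinvariants are determined, and for push-forwards, whose coinvariants are never
    computed. *)
Definition base_comodule (E : extension_data H phi) : Prop :=
  algebra_morphism (coact E) /\
  forall r, coact E (scalar_map (ext_alg E) r) = base_map _ r.

Lemma coactZ (E : extension_data H phi) r (a : ext_alg E) :
  base_comodule E -> coact E (r *: a) = base_map _ r * coact E a.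
Proof. by case=> [[_ [_ dM]] dC]; rewrite -scalar_mapE dM dC. Qed.

Variables (n : nat) (q : k).
Local Notation N := n.+1.
Variables X Y : H.
Hypothesis q_prim : N.-primitive_root q.
Hypothesis XY : taft_relations N q X Y.

Section CoactionRelations.
Variables (A : assocAlg R) (x y : A).
Hypothesis yx : y * x = phi q *: (x * y).
Local Notation AH := (tensor_alg (restrict phi A) H).
Local Notation P := ((x : restrict phi A) \ox X : AH).
Local Notation Q := ((1 : restrict phi A) \ox Y + (y : restrict phi A) \ox X : AH).

Lemma coaction_xN : P ^+ N = (x ^+ N : restrict phi A) \ox (1 : H).
Proof. by rewrite tensor_mulX; have [-> _ _] := XY. Qed.

Lemma coaction_yx : Q * P = base_map A (phi q) * (P * Q).
Proof.
have [_ _ YX] := XY.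
rewrite base_map_phi -alg_scaleAl mul1r mulrDl mulrDr !tensor_mulM mul1r mulr1.
rewrite YX scalerDr -tensorZr; congr (_ + _).
by rewrite tensorZl; congr (_ \ox _); exact: yx.
Qed.

(** The two summands of [Q] q-commute through their factors in H, so the N-th power is additive;
    then Y^N = 0 and X^N = 1. *)
Lemma coaction_yN : Q ^+ N = (y ^+ N : restrict phi A) \ox (1 : H).
Proof.
have [XN YN YX] := XY.
rewrite addrC (qbinomial_prim _ q_prim); last first.
  by rewrite !tensor_mulM mul1r mulr1 YX tensorZr.
by rewrite !tensor_mulX YN tmul0r addr0 XN.
Qed.

End CoactionRelations.

Definition taft_gens (E : extension_data H phi) (a b : R) (x y : ext_alg E) : Prop :=
  [/\ x ^+ N = scalar_map _ a, y ^+ N = scalar_map _ b, y * x = phi q *: (x * y),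
      coact E x = (x : E) \ox X & coact E y = (1 : E) \ox Y + (y : E) \ox X].

Section ModelHom.
Variables a b : R.
Hypothesis wN : phi q ^+ N = 1.
Local Notation MA := (model_alg a b wN).

(** Reduces compatibility with coactions, coassociativity and the counit axiom to a check on
    scalars, x and y. *)
Lemma model_hom_ext (B : pzRingType) (f g : MA -> B) :
    {morph f : s t / s + t} -> {morph g : s t / s + t} ->
    monoid_morphism f -> monoid_morphism g ->
    (forall r, f (scalar_map MA r) = g (scalar_map MA r)) ->
    f (model_x a b wN) = g (model_x a b wN) ->
    f (model_y a b wN) = g (model_y a b wN) ->
  f =1 g.
Proof.
move=> fD gD fM gM fgr fgx fgy s.
apply: (@model_ind R n a b (fun s => f s = g s)) => [r i j|{}s t IHs IHt]; last first.
  by rewrite fD gD IHs IHt.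
have -> : r *: mono n a b i j =
    scalar_map MA r * (model_x a b wN ^+ i * model_y a b wN ^+ j).
  by rewrite model_monoE scalar_mapE.
rewrite fM.2 gM.2 fM.2 gM.2 !(monoid_morphismX fM) !(monoid_morphismX gM).
by rewrite fgr fgx fgy.
Qed.

Definition model_coact : restrict phi MA -> tensor_alg (restrict phi MA) H :=
  model_eval (base_map MA) ((model_x a b wN : restrict phi MA) \ox X)
    ((1 : restrict phi MA) \ox Y + (model_y a b wN : restrict phi MA) \ox X).

Definition model_ext : extension_data H phi := ExtensionData model_coact.

Lemma model_coact_hom :
  [/\ {morph model_coact : s t / s + t}, monoid_morphism model_coact,
      forall r, model_coact (scalar_map MA r) = base_map MA r
    & taft_gens (E := model_ext) a b (model_x a b wN) (model_y a b wN)].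
Proof.
have xN := model_xN a b wN; have yN := model_yN a b wN; have yx := model_yx a b wN.
have dx := coaction_xN (model_x a b wN); have dy := coaction_yN (model_y a b wN).
have dyx := coaction_yx yx; rewrite xN in dx; rewrite yN in dy.
have dP r := @base_map_comm MA r ((model_x a b wN : restrict phi MA) \ox X).
have dQ r := @base_map_comm MA r
  ((1 : restrict phi MA) \ox Y + (model_y a b wN : restrict phi MA) \ox X).
split.
- exact: model_evalD.
- split; first by apply: model_eval1.
  by move=> s t; apply: model_evalM.
- move=> r; rewrite [LHS]model_evalZ [X in _ * X]model_eval1 ?mulr1 //.
split=> //; first by apply: model_evalx.
by apply: model_evaly.
Qed.

Lemma model_base_comodule : base_comodule model_ext.
Proof.
have [dD dM dr _] := model_coact_hom; split=> //; split=> // c s t.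
rewrite [LHS]dD; congr (_ + _).
rewrite [LHS](_ : _ = model_coact (scalar_map MA (phi c) * s)).
  by rewrite dM.2 dr base_map_phi -alg_scaleAl mul1r.
by rewrite scalar_mapE.
Qed.

Variables (E : extension_data H phi) (x y : ext_alg E).
Hypothesis E_comod : base_comodule E.
Hypothesis E_gens : taft_gens a b x y.

Definition model_hom : MA -> ext_alg E := model_eval (scalar_map (ext_alg E)) x y.

Lemma model_homP :
  [/\ forall r s, model_hom (r *: s) = r *: model_hom s,
      {morph model_hom : s t / s + t}, monoid_morphism model_hom,
      model_hom (model_x a b wN) = x & model_hom (model_y a b wN) = y].
Proof.
have [xN yN yx _ _] := E_gens.
have cx r := scalar_map_comm r x; have cy r := scalar_map_comm r y.
have yx' : y * x = scalar_map (ext_alg E) (phi q) * (x * y) by rewrite scalar_mapE.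
split.
- by move=> r s; rewrite /model_hom model_evalZ scalar_mapE.
- exact: model_evalD.
- by split; [apply: model_eval1 | move=> s t; apply: model_evalM].
- by apply: model_evalx.
- by apply: model_evaly.
Qed.

Lemma model_hom_morphism :
  algebra_morphism (model_hom : restrict phi MA -> restrict phi (ext_alg E)).
Proof.
have [hZ hD hM _ _] := model_homP; split=> // c s t.
by rewrite [LHS]hD; congr (_ + _); exact: hZ.
Qed.

Lemma model_hom_coact s :
  coact E (model_hom s) = tmap (model_hom : model_ext -> E) id (coact model_ext s).
Proof.
have [hZ hD hM hx hy] := model_homP; have hmor := model_hom_morphism.
have [[dl dM] dr] := E_comod; have [[ml mM] mr] := model_base_comodule.
have [tl tM] := tmap_algebra_morphism hmor (id_algebra_morphism H).
have [_ _ _ dx dy] := E_gens; have [_ _ _ [_ _ _ mx my]] := model_coact_hom.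
apply: (@model_hom_ext _ (fun s => coact E (model_hom s))
  (fun s => tmap (model_hom : model_ext -> E) id (coact model_ext s))).
- by move=> u v; rewrite hD (linear_funD dl).
- by move=> u v; rewrite (linear_funD ml) (linear_funD tl).
- by split=> [|u v]; rewrite ?hM.1 ?dM.1 // hM.2 dM.2.
- by split=> [|u v]; rewrite ?mM.1 ?tM.1 // mM.2 tM.2.
- move=> r; rewrite mr [in LHS]/scalar_map hZ hM.1 dr tmap_tmul //; last exact: hmor.1.
  by congr (_ \ox _); rewrite [in RHS]/scalar_map hZ hM.1.
- by rewrite hx dx mx tmap_tmul ?hx //; exact: hmor.1.
rewrite hy dy my (linear_funD tl) !tmap_tmul ?hy; try exact: hmor.1; try by [].
by rewrite hmor.2.1.
Qed.

End ModelHom.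
End Extensions.

(** * Bijectivity of Galois maps *)

Lemma alg_exprZ (R : comPzRingType) (A : assocAlg R) r (x : A) n :
  (r *: x) ^+ n = r ^+ n *: x ^+ n.
Proof.
elim: n => [|n IHn]; first by rewrite !expr0 scale1r.
by rewrite !exprS IHn -alg_scaleAl -alg_scaleAr scalerA.
Qed.

Section Opposite.
Variables (R : comPzRingType) (A : assocAlg R).

Definition op_alg : assocAlg R :=
  @AssocAlg R A 1 (fun x y : A => y * x) (fun x y z => esym (mulrA z y x))
    (@mulr1 A) (@mul1r A) (fun x y z => mulrDr z x y) (fun x y z => mulrDl y z x)
    (fun r x y => esym (alg_scaleAr r y x)) (fun r x y => esym (alg_scaleAl r y x)).

Lemma op_expr (x : A) n : (x : op_alg) ^+ n = x ^+ n.
Proof. by elim: n => // n IHn; rewrite exprS IHn [RHS]exprSr. Qed.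

End Opposite.

Section Translation.
Variables (k : fieldType) (H : hopfAlgebra k).
Variables (R : comNzRingType) (phi : {rmorphism k -> R}).
Variables (n : nat) (q : k).
Local Notation N := n.+1.
Variables X Y : H.
Hypothesis q_prim : N.-primitive_root q.
Hypothesis XY : taft_relations N q X Y.
Hypothesis H_universal : taft_universal N q X Y.
Hypothesis H_dim : exists f : {linear 'rV[k]_(N ^ 2) -> alg_sort H}, bijective f.
Variables (a a' b : R).
Hypothesis wN : phi q ^+ N = 1.
Hypothesis aV : a * a' = 1.
Local Notation MA := (model_alg a b wN).
Variables (E : extension_data H phi) (x0 y0 : ext_alg E).
Hypothesis E_comod : base_comodule E.
Hypothesis E_gens : taft_gens n q X Y a b x0 y0.
Local Notation EA := (ext_alg E).
Local Notation EK := (restrict phi EA).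
Local Notation EH := (tensor_alg EK H).
Local Notation f := (@model_hom k H R phi n q a b wN E x0 y0).
Local Notation D := (tensor_alg (op_alg EA) MA).
Local Notation x := (model_x a b wN).
Local Notation y := (model_y a b wN).
Local Notation xi := (a' *: x0 ^+ n).

Lemma xi_mulr : x0 * xi = 1.
Proof.
have [xN _ _ _ _] := E_gens.
by rewrite -alg_scaleAr -exprS xN /scalar_map scalerA mulrC aV scale1r.
Qed.

Lemma xi_mull : xi * x0 = 1.
Proof.
have [xN _ _ _ _] := E_gens.
by rewrite -alg_scaleAl -exprSr xN /scalar_map scalerA mulrC aV scale1r.
Qed.

Lemma xi_y : xi * y0 = phi q *: (y0 * xi).
Proof.
have [_ _ yx _ _] := E_gens.
have [zr zl] := (xi_mulr, xi_mull); move: (xi) zr zl => z zr zl.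
have -> : z * y0 = z * (y0 * x0) * z by rewrite -!mulrA zr mulr1.
by rewrite yx -alg_scaleAr -alg_scaleAl [z * _]mulrA zl mul1r.
Qed.

Lemma xiN : a *: xi ^+ N = 1.
Proof.
have [xN _ _ _ _] := E_gens.
rewrite -scalar_mapE -xN -exprMn_comm ?xi_mulr ?expr1n //.
by rewrite /GRing.comm xi_mulr xi_mull.
Qed.

Lemma D_mul (s s' : EA) (e e' : MA) :
  ((s : op_alg EA) \ox e : D) * ((s' : op_alg EA) \ox e' : D) =
  ((s' * s : op_alg EA) \ox (e * e')).
Proof. exact: tensor_mulM. Qed.

Lemma D_exp (s : EA) (e : MA) m :
  ((s : op_alg EA) \ox e : D) ^+ m = ((s ^+ m : op_alg EA) \ox (e ^+ m)).
Proof. by rewrite tensor_mulX op_expr. Qed.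

Lemma D_swap (s : EA) (e : MA) r :
  ((s : op_alg EA) \ox (r *: e) : D) = ((r *: s : op_alg EA) \ox e).
Proof. by rewrite -tmulZ. Qed.

Local Notation P := ((xi : op_alg EA) \ox x : D).
Local Notation U := ((1 : op_alg EA) \ox y : D).
Local Notation V := ((- (y0 * xi) : op_alg EA) \ox x : D).

(* The translation map h |-> (galois map)^-1 (1 \ox h) is an algebra morphism
   from H to A^op \ox E, sending X to x^-1 \ox x and Y to
   1 \ox y - y x^-1 \ox x; these are the images P and V + U below. *)
Lemma translation_relations :
  taft_relations N q (P : restrict phi D) (V + U : restrict phi D).
Proof.
have [xN yN yx _ _] := E_gens.
have MxN := model_xN a b wN; have MyN := model_yN a b wN; have Myx := model_yx a b wN.
have UV : U * V = phi q *: (V * U).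
  by rewrite !D_mul mulr1 mul1r Myx D_swap tensorZl.
split.
- rewrite [LHS]D_exp MxN D_swap; congr (_ \ox _); exact: xiN.
- have -> : (V + U : restrict phi D) ^+ N =
      (V : restrict phi D) ^+ N + (U : restrict phi D) ^+ N.
    exact: (@qbinomial_prim k q (restrict phi D) V U UV N q_prim).
  have yxiN : (y0 * xi) ^+ N = phi (q ^+ 'C(N, 2)) *: (y0 ^+ N * xi ^+ N).
    exact: (@qcomm_exprM k q EK y0 xi xi_y).
  (* This must cancel U^N = 1 \ox b. The factor (-1)^N from the sign of [V] and q^C(N,2) from
     reordering (y0 xi)^N multiply to -1, and the x^N = a of the model absorbs xi^N. *)
  have -> : (V : restrict phi D) ^+ N = - ((scalar_map EA b : op_alg EA) \ox (1 : MA)).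
    rewrite [LHS]D_exp MxN D_swap -scaleN1r alg_exprZ yxiN yN scalar_mapE.
    rewrite -tmulNl; congr (_ \ox _).
    have sgn : (-1) ^+ N * phi (q ^+ 'C(N, 2)) = -1.
      by rewrite -(rmorphN1 phi) -rmorphXn -rmorphM prim_root_expr_bin2 ?rmorphN1.
    rewrite !scalerA -[a * _ * _]mulrA sgn.
    have -> : a * -1 * b = - b * a by ring.
    by rewrite -scalerA xiN scaleNr.
  by rewrite [X in _ + X]D_exp expr1n MyN D_swap addNr.
have -> : (V + U : restrict phi D) * (P : restrict phi D) = V * P + U * P.
  exact: (@mulrDl D V U P).
have -> : (P : restrict phi D) * (V + U : restrict phi D) = P * V + P * U.
  exact: (@mulrDr D P V U).
rewrite scalerDr; congr (_ + _).
  rewrite !D_mul mulrN mulNr mulrA xi_y -alg_scaleAl.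
  by rewrite -scalerN [RHS]tensorZl.
by rewrite !D_mul mulr1 mul1r Myx D_swap [RHS]tensorZl.
Qed.

(** The Galois map of E composed with id \ox f. Unlike the Galois map itself, it can be inverted
    explicitly without assuming that E is Galois. *)
Definition galois_via : tensor (alg_sort EA) (alg_sort MA) -> EH :=
  tlift (fun (s : EA) (e : MA) => ((s : EK) \ox (1 : H) : EH) * coact E (f e)).

Lemma galois_via_balanced :
  balanced (fun (s : EA) (e : MA) => ((s : EK) \ox (1 : H) : EH) * coact E (f e)).
Proof.
have [hZ hD _ _ _] := model_homP wN E_gens; have [[dl dM] dr] := E_comod.
split=> [s s' e|s e e'|r s e].
- by rewrite -mulrDl -tmulDl.
- by rewrite hD (linear_funD dl) mulrDr.
by rewrite hZ coactZ // mulrA -(base_map_comm r) base_mapE.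
Qed.

Lemma galois_via_tmul (s : EA) (e : MA) :
  galois_via (s \ox e) = ((s : EK) \ox (1 : H) : EH) * coact E (f e).
Proof. exact/tliftE/galois_via_balanced. Qed.

Lemma galois_viaD s t : galois_via (s + t) = galois_via s + galois_via t.
Proof. exact/tliftD/galois_via_balanced. Qed.

(** Right multiplication in [D] puts s in front and e at the back; this is why the first factor
    carries the opposite product. *)
Lemma galois_via_mulr (t : D) (s : EA) (e : MA) :
  galois_via (t * ((s : op_alg EA) \ox e : D)) =
  ((s : EK) \ox (1 : H) : EH) * galois_via t * coact E (f e).
Proof.
have [_ _ [_ hM] _ _] := model_homP wN E_gens; have [[_ [_ dM]] _] := E_comod.
elim/tensor_ind: t => [s' e'|t t' IHt IHt']; last first.
  by rewrite mulrDl !galois_viaD IHt IHt' mulrDr mulrDl.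
rewrite D_mul !galois_via_tmul hM dM !mulrA; congr (_ * _ * _).
by rewrite tensor_mulM mulr1.
Qed.

(** Since 1 \ox h commutes with every s \ox 1, it can be pulled to the front. Hence the identity
    [tau_gal] below passes to products in H. *)
Lemma galois_via_mull (t s : D) (h : H) : galois_via t = (1 : EK) \ox h ->
  galois_via (t * s) = ((1 : EK) \ox h : EH) * galois_via s.
Proof.
move=> th; elim/tensor_ind: s => [s e|s s' IHs IHs']; last first.
  by rewrite mulrDr !galois_viaD IHs IHs' mulrDr.
rewrite galois_via_mulr th galois_via_tmul mulrA; congr (_ * _).
by rewrite !tensor_mulM !mulr1 !mul1r.
Qed.

(** The inverse is built from the translation map [tau]; one composite is checked on the generators
    of H, the other on those of the model. *)
Lemma galois_via_bij : bijective galois_via.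
Proof.
have [tau [[tau_lin [tau1 tauM]] tauX tauY] _] := H_universal translation_relations.
have [hZ hD [h1 hM] hx hy] := model_homP wN E_gens.
have [[dl [d1 dM]] dr] := E_comod; have [xN yN yx dx dy] := E_gens.
have gal1 : galois_via (1 : D) = 1 by rewrite galois_via_tmul h1 d1 mulr1.
have galZ c (t : restrict phi D) : galois_via (c *: t) = c *: galois_via t.
  elim/tensor_ind: t => [s e|s s' IHs IHs']; last first.
    by rewrite scalerDr !galois_viaD IHs IHs' scalerDr.
  rewrite [in LHS](_ : c *: (s \ox e : restrict phi D) = (phi c *: s) \ox e).
    by rewrite !galois_via_tmul alg_scaleAl tensorZl.
  exact: tensorZl.
have tau_gal h : galois_via (tau h) = (1 : EK) \ox h.
  elim/(taft_ind (prim_expr_order q_prim) H_universal H_dim): h => [|||h h' IHh IHh'|h h' IHh IHh'|r h IHh].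
  - by rewrite tau1 gal1.
  - rewrite tauX galois_via_tmul hx dx tensor_mulM mul1r.
    by congr (_ \ox _); exact: xi_mull.
  - rewrite tauY galois_viaD !galois_via_tmul hx hy dx dy mul1r tensor_mulM mul1r.
    have -> : (- (y0 * xi) : EK) * (x0 : EK) = - (y0 : EK).
      rewrite mulNr; congr (- _).
      have : y0 * xi * x0 = y0 by rewrite -mulrA xi_mull mulr1.
      exact.
    by rewrite tmulNl addrC addrK.
  - by rewrite tauM (galois_via_mull _ IHh) IHh' tensor_mulM mulr1.
  - by rewrite (linear_funD tau_lin) galois_viaD IHh IHh' tmulDr.
  - by rewrite (linear_funZ tau_lin) galZ IHh tensorZr.
(* The inverse sends s \ox h to s times the translation of h, which in the opposite algebra is a
   product on the right. *)
pose G : EH -> D := tlift (fun (s : EK) (h : H) =>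
  (tau h : D) * ((s : op_alg EA) \ox (1 : MA) : D)).
have G_bal : balanced (fun (s : EK) (h : H) =>
    (tau h : D) * ((s : op_alg EA) \ox (1 : MA) : D)).
  split=> [s s' h|s h h'|r s h].
  - by rewrite -mulrDr -tmulDl.
  - by rewrite (linear_funD tau_lin) -mulrDl.
  rewrite (linear_funZ tau_lin).
  rewrite [_ * _ in RHS](_ : _ = 
      phi r *: ((tau h : D) * ((s : op_alg EA) \ox (1 : MA) : D))).
    by rewrite alg_scaleAr tensorZl.
  by rewrite alg_scaleAl.
have GE s h : G (s \ox h) = (tau h : D) * ((s : op_alg EA) \ox (1 : MA) : D).
  exact: tliftE.
have GD : {morph G : s t / s + t} by exact: tliftD.
have G_mul (s : EK) h w : G (((s \ox h) : EH) * w) =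
    (tau h : D) * G w * ((s : op_alg EA) \ox (1 : MA) : D).
  elim/tensor_ind: w => [s' h'|w w' IHw IHw']; last first.
    by rewrite mulrDr !GD IHw IHw' mulrDr mulrDl.
  rewrite tensor_mulM !GE tauM -!mulrA; congr (_ * (_ * _)).
  by rewrite D_mul mulr1.
(* By [step] the property is multiplicative in e, so scalars, x and y suffice. *)
have G_coact e : G (coact E (f e)) = (1 : op_alg EA) \ox e.
  have step z w (e1 e2 : MA) : G z = (1 : op_alg EA) \ox e1 ->
      G w = (1 : op_alg EA) \ox e2 -> G (z * w) = (1 : op_alg EA) \ox (e1 * e2).
    move=> Gz Gw; have -> : G (z * w) = G z * ((1 : op_alg EA) \ox e2 : D).
      elim/tensor_ind: z {Gz} => [s h|z z' IHz IHz']; last first.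
        by rewrite mulrDl !GD IHz IHz' mulrDl.
      by rewrite G_mul Gw GE -!mulrA !D_mul !mulr1 !mul1r.
    by rewrite Gz D_mul mulr1.
  have G1 : G 1 = (1 : op_alg EA) \ox (1 : MA) by rewrite GE tau1 mul1r.
  apply: (@model_ind R n a b
    (fun e => G (coact E (f e)) = (1 : op_alg EA) \ox (e : MA)))
    => [r i j|e1 e2 IH1 IH2].
    have powS (e1 : MA) m : G (coact E (f e1)) = (1 : op_alg EA) \ox e1 ->
        G (coact E (f (e1 ^+ m))) = (1 : op_alg EA) \ox (e1 ^+ m).
      move=> e1S; elim: m => [|m IHm]; first by rewrite h1 d1.
      by rewrite exprS hM dM; apply: (step).
    have -> : r *: mono n a b i j = scalar_map MA r * (x ^+ i * y ^+ j).
      by rewrite model_monoE scalar_mapE.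
    rewrite hM dM; apply: (step).
      rewrite /scalar_map hZ h1 dr GE tau1 mul1r D_swap; congr (_ \ox _).
    rewrite hM dM; apply: (step); apply: (powS).
      by rewrite hx dx GE tauX D_mul mulr1 xi_mulr.
    rewrite hy dy GD !GE tauX tauY [X in X + _]mulr1 D_mul mulr1 tmulNl.
    by rewrite addrAC addNr add0r.
  by rewrite hD (linear_funD dl) GD IH1 IH2 tmulDr.
exists G => [t|t]; elim/tensor_ind: t => [s h|t t' IHt IHt'].
- by rewrite galois_via_tmul G_mul tau1 G_coact mul1r D_mul !mulr1.
- by rewrite galois_viaD GD IHt IHt'.
- by rewrite GE galois_via_mulr tau_gal h1 d1 mulr1 tensor_mulM mulr1 mul1r.
- by rewrite GD galois_viaD IHt IHt'.
Qed.

End Translation.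

(** * Faithful flatness and descent *)

Lemma injective_surjective_bijective (A B : Type) (f : A -> B) :
  injective f -> (forall b, exists a, f a = b) -> bijective f.
Proof.
move=> f_inj /choice[g gK]; exists g => // a.
by apply: f_inj; rewrite gK.
Qed.

Section FreeFlat.
Variables (R : comPzRingType) (A : lmodType R) (I : finType).
Variables (e : I -> A) (co : I -> A -> R) (i0 : I).
Hypothesis e_basis : coord_basis e co.

Definition tensor_coord (M : lmodType R) (i : I) : tensor A M -> M :=
  tlift (fun (a : A) (m : M) => co i a *: m).

Lemma tensor_coord_balanced (M : lmodType R) i :
  balanced (fun (a : A) (m : M) => co i a *: m).
Proof.
have [co_lin _ _] := e_basis; split=> [a a' m|a m m'|r a m].
- by rewrite (linear_funD (co_lin i)) scalerDl.
- by rewrite scalerDr.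
- by rewrite (linear_funZ (co_lin i)) scalerA [in RHS]mulrC.
Qed.

Lemma tensor_coord_tmul (M : lmodType R) i a (m : M) :
  tensor_coord i (a \ox m) = co i a *: m.
Proof. exact/tliftE/tensor_coord_balanced. Qed.

Lemma tensor_coordD (M : lmodType R) i : {morph @tensor_coord M i : s t / s + t}.
Proof. exact/tliftD/tensor_coord_balanced. Qed.

Lemma tensor_coord_decomp (M : lmodType R) (t : tensor A M) :
  t = \sum_i e i \ox tensor_coord i t.
Proof.
have [_ _ coE] := e_basis; elim/tensor_ind: t => [a m|s t IHs IHt].
  have tD (a1 a2 : A) : (a1 + a2) \ox m = a1 \ox m + a2 \ox m by exact: tmulDl.
  rewrite {1}(coE a) (big_morph (fun a => a \ox m) tD (tmul0l _ m)).
  by apply: eq_bigr => i _; rewrite tensor_coord_tmul tmulZ.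
rewrite {1}IHs {1}IHt -big_split; apply: eq_bigr => i _ /=.
by rewrite tensor_coordD tmulDr.
Qed.

Lemma tensor_coord_tmap (M M' : lmodType R) (f : {linear M -> M'}) i t :
  tensor_coord i (tmap id f t) = f (tensor_coord i (t : tensor A M)).
Proof.
have fl : linear f by move=> r x y; rewrite linearP.
elim/tensor_ind: t => [a m|s t IHs IHt].
  by rewrite tmap_tmul // !tensor_coord_tmul linearZ.
rewrite (linear_funD (tmap_linear (@id_linear _ A) fl)) !tensor_coordD IHs IHt.
by rewrite linearD.
Qed.

(** Through the coordinates, A \ox M is a power of M on which id \ox f acts componentwise. The index
    [i0] makes the power nonempty, so that exactness is also reflected. *)
Lemma free_faithfully_flat : faithfully_flat A.
Proof.
move=> M1 M2 M3 f g.
have tE (M M' : lmodType R) (h : {linear M -> M'}) (a : A) m :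
    tmap id h (a \ox m) = a \ox h m.
  by rewrite tmap_tmul // => r x y; rewrite linearP.
have [_ coe _] := e_basis.
have coord1 (M : lmodType R) (m : M) : tensor_coord i0 (e i0 \ox m) = m.
  by rewrite tensor_coord_tmul coe eqxx scale1r.
have coord0 (M : lmodType R) (t : tensor A M) :
    (forall i, tensor_coord i t = 0) -> t = 0.
  move=> t0; rewrite (tensor_coord_decomp t) big1 // => i _.
  by rewrite t0 tmul0r.
have coord00 (M : lmodType R) i : tensor_coord i (0 : tensor A M) = 0.
  exact/tlift0/tensor_coord_balanced.
split=> fg y; split.
- move=> gy; have /choice[m fm] i : exists m, f m = tensor_coord i y.
    by apply/fg; rewrite -tensor_coord_tmap gy coord00.
  exists (\sum_i e i \ox m i).
  have fl : linear f by move=> r x z; rewrite linearP.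
  rewrite (linear_fun_sum (tmap_linear (@id_linear _ A) fl)).
  rewrite [RHS]tensor_coord_decomp; apply: eq_bigr => i _.
  by rewrite tE fm.
- move=> [x xy]; apply: coord0 => i; rewrite tensor_coord_tmap.
  by apply/fg; exists (tensor_coord i x); rewrite -tensor_coord_tmap xy.
- move=> gy; have /fg[x xy] : tmap id g (e i0 \ox y) = 0 by rewrite tE gy tmul0r.
  by exists (tensor_coord i0 x); rewrite -tensor_coord_tmap xy coord1.
- move=> [x xy]; have e0 : tmap id g (e i0 \ox y) = 0.
    by apply/fg; exists (e i0 \ox x); rewrite tE xy.
  by rewrite -[LHS]coord1 -tE e0 coord00.
Qed.

End FreeFlat.

Section FlatDescent.
Variables (R : comPzRingType) (A : lmodType R).
Hypothesis A_ff : faithfully_flat A.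

(* Faithful flatness applied to the sequences 0 -> M -> M' and M -> M' -> 0. *)
Lemma faithfully_flat_bijective (M M' : lmodType R) (f : M -> M') :
  linear f -> bijective (@tmap R A A M M' id f) -> bijective f.
Proof.
move=> f_lin tf_bij; have tf_inj := bij_inj tf_bij.
pose fL : {linear M -> M'} := HB.pack f (GRing.isLinear.Build _ _ _ _ f f_lin).
have tf_lin := tmap_linear (@id_linear _ A) f_lin.
have t0 (P Q : lmodType R) t : tmap id (\0 : {linear P -> Q}) (t : tensor A P) = 0.
  have z_lin : linear (\0 : P -> Q) by move=> r x y; rewrite /= scaler0 addr0.
  elim/tensor_ind: t => [a m|s t IHs IHt]; first by rewrite tmap_tmul // tmul0r.
  by rewrite (linear_funD (tmap_linear (@id_linear _ A) z_lin)) IHs IHt addr0.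
have ex1 : exact_at (\0 : {linear M -> M}) fL.
  apply/A_ff => t; split=> [ft|[s <-]]; last by rewrite t0 (linear_fun0 tf_lin).
  by exists 0; rewrite t0; apply: tf_inj; rewrite (linear_fun0 tf_lin) ft.
have ex2 : exact_at fL (\0 : {linear M' -> M'}).
  apply/A_ff => t; split=> [_|_]; last by rewrite t0.
  by have [g _ gK] := tf_bij; exists (g t).
apply: injective_surjective_bijective => [x y fxy|y]; last exact/ex2.
apply/eqP; rewrite -subr_eq0; apply/eqP.
have /ex1[z <-] // : fL (x - y) = 0 by rewrite linearB /= fxy subrr.
Qed.

End FlatDescent.

Section BaseComodule.
Variables (k : fieldType) (H : hopfAlgebra k).
Variables (R : comNzRingType) (phi : {rmorphism k -> R}).
Variable E : extension_data H phi.

Lemma extension_base_comodule : is_extension E -> base_comodule E.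
Proof. by case=> -[E_mor _ _] _ coinv; split=> // r; apply/coinv; exists r. Qed.

Hypothesis E_comod : base_comodule E.

Lemma galois_map_balanced : balanced (fun a b : ext_alg E =>
  ((a : E) \ox (1 : H) : tensor_alg E H) * coact E b).
Proof.
have [[dl _] _] := E_comod.
split=> [s s' e|s e e'|r s e].
- by rewrite -mulrDl -tmulDl.
- by rewrite (linear_funD dl) mulrDr.
by rewrite coactZ // mulrA -(base_map_comm r) base_mapE.
Qed.

Lemma galois_map_tmul (a b : ext_alg E) :
  galois_map (a \ox b) = ((a : E) \ox (1 : H) : tensor_alg E H) * coact E b.
Proof. exact/tliftE/galois_map_balanced. Qed.

Lemma galois_mapD s t :
  galois_map (s + t) = galois_map s + galois_map t :> tensor_alg E H.
Proof. exact/tliftD/galois_map_balanced. Qed.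

End BaseComodule.

Lemma model_coord_basis (R : comNzRingType) n (w a b : R) (wN : w ^+ n.+1 = 1) :
  coord_basis
    (fun p : 'I_n.+1 * 'I_n.+1 => model_x a b wN ^+ p.1 * model_y a b wN ^+ p.2)
    (fun p (f : model_alg a b wN) => (f : {ffun _ -> R^o}) p).
Proof.
split=> [p r s t|p p'|s].
- by rewrite [LHS]ffunE [X in X + _]ffunE.
- by rewrite model_monoE mono_ord.
rewrite [LHS](model_decomp a b); apply: eq_bigr => p _.
by rewrite model_monoE.
Qed.

(** * The comodule algebras E(a, b) as quantum principal bundles *)

Section ModelBundle.
Variables (k : fieldType) (H : hopfAlgebra k).
Variables (R : comNzRingType) (phi : {rmorphism k -> R}).
Variables (n : nat) (q : k).
Local Notation N := n.+1.
Variables X Y : H.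
Hypothesis q_prim : N.-primitive_root q.
Hypothesis XY : taft_relations N q X Y.
Hypothesis H_universal : taft_universal N q X Y.
Hypothesis H_dim : exists f : {linear 'rV[k]_(N ^ 2) -> alg_sort H}, bijective f.
Hypothesis comulX : comul X = X \ox X.
Hypothesis comulY : comul Y = (1 : H) \ox Y + Y \ox X.
Hypothesis counitX : counit X = 1.
Hypothesis counitY : counit Y = 0.
Variables (a a' b : R).
Hypothesis wN : phi q ^+ N = 1.
Hypothesis aV : a * a' = 1.
Local Notation MA := (model_alg a b wN).
Local Notation ME := (model_ext X Y a b wN).
Local Notation x := (model_x a b wN).
Local Notation y := (model_y a b wN).

Section Hom.
Variables (E : extension_data H phi) (x0 y0 : ext_alg E).
Hypothesis E_bundle : is_bundle E.
Hypothesis E_gens : taft_gens n q X Y a b x0 y0.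
Local Notation f := (@model_hom k H R phi n q a b wN E x0 y0).

Lemma model_hom_bij : bijective f.
Proof.
have [E_ext E_gal E_ff] := E_bundle; have E_comod := extension_base_comodule E_ext.
have [hZ hD _ _ _] := model_homP wN E_gens.
have f_lin : linear f by move=> r s t; rewrite hD hZ.
apply: (faithfully_flat_bijective E_ff f_lin).
have gvE t : galois_via x0 y0 t = galois_map (tmap id f t).
  elim/tensor_ind: t => [s e|s t IHs IHt].
    by rewrite (galois_via_tmul E_comod E_gens) tmap_tmul // galois_map_tmul.
  rewrite (galois_viaD E_comod E_gens).
  rewrite (linear_funD (tmap_linear (@id_linear _ _) f_lin)).
  by rewrite galois_mapD // IHs IHt.
have gv_bij := galois_via_bij q_prim H_universal H_dim wN aV E_comod E_gens.
have [g gK gK'] := E_gal.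
apply: (@eq_bij _ _ (g \o galois_via x0 y0)); last by move=> t /=; rewrite gvE gK.
by apply: bij_comp gv_bij; exists (@galois_map _ _ _ _ E).
Qed.

End Hom.

Lemma model_comodule_algebra : comodule_algebra ME.
Proof.
have ME_comod := model_base_comodule q_prim XY a b wN.
have [[dl [d1 dM]] dr] := ME_comod.
have [_ _ _ [_ _ _ dx dy]] := model_coact_hom q_prim XY a b wN.
have dmor : algebra_morphism (@coact _ _ ME) by [].
have [Dl [D1 DM]] := comul_morph H; have [el [e1 eM]] := counit_morph H.
have ilE := @id_linear k (alg_sort ME); have ilH := @id_linear k (alg_sort H).
split=> //.
- have [t1l [t11 t1M]] := tmap_algebra_morphism dmor (id_algebra_morphism H).
  have [t2l [t21 t2M]] :=
    tmap_algebra_morphism (id_algebra_morphism ME) (comul_morph H).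
  apply: (@model_hom_ext _ _ phi n q a b wN _
    (fun s => tassoc (tmap (@coact _ _ ME) id (coact ME s))
       : tensor_alg ME (tensor_alg H H))
    (fun s => tmap id (@comul _ H) (coact ME s))).
  + by move=> s t; rewrite (linear_funD dl) (linear_funD t1l) tassocD.
  + by move=> s t; rewrite (linear_funD dl) (linear_funD t2l).
  + by split=> [|s t]; rewrite ?d1 ?t11 ?tassoc1 // dM t1M tassocM.
  + by split=> [|s t]; rewrite ?d1 ?t21 // dM t2M.
  + by move=> r; rewrite dr /base_map !tmap_tmul // dr tassoc_tmul D1.
  + by rewrite dx !tmap_tmul // dx tassoc_tmul comulX.
  + rewrite dy (linear_funD t1l) (linear_funD t2l) !tmap_tmul // d1 dy comulX comulY.
    by rewrite tmulDl !tassocD !tassoc_tmul tmulDr -!addrA.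
pose c (s : ME) (h : H) : ME := counit h *: s.
have c_bal : balanced c.
  split=> [s s' h|s h h'|r s h]; rewrite /c.
  - by rewrite scalerDr.
  - by rewrite (linear_funD el) scalerDl.
  - by rewrite (linear_funZ el) !scalerA mulrC.
have [tl1 tlM] : monoid_morphism (tlift c : tensor_alg ME H -> ME).
  apply: tlift_monoid_morphism => //; first by rewrite /c e1 scale1r.
  by move=> s h s' h'; rewrite /c eM -alg_scaleAl -alg_scaleAr scalerA.
have tlD : {morph (tlift c : tensor_alg ME H -> ME) : s t / s + t} by exact: tliftD.
apply: (@model_hom_ext _ _ phi n q a b wN MA (fun s => tlift c (coact ME s)) id) => //.
- by move=> s t; rewrite (linear_funD dl) tlD.
- by split=> [|s t]; rewrite ?d1 // dM tlM.
- by move=> r; rewrite dr tliftE // /c e1 scale1r.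
- by rewrite dx tliftE // /c counitX scale1r.
- by rewrite dy tlD !tliftE // /c counitX counitY scale1r scale0r add0r.
Qed.

Lemma model_bundle : is_bundle ME.
Proof.
have ME_comod := model_base_comodule q_prim XY a b wN.
have [_ _ _ ME_gens] := model_coact_hom q_prim XY a b wN.
have ff : faithfully_flat (alg_sort MA).
  exact: (free_faithfully_flat (ord0, ord0) (model_coord_basis a b wN)).
have gal : bijective (@galois_map _ _ _ _ ME).
  have gv_bij := galois_via_bij q_prim H_universal H_dim wN aV ME_comod ME_gens.
  apply: (eq_bij gv_bij) => t.
  (* With the model itself as E the comparison map is the identity, so [galois_via] is the Galois
     map. *)
  have hid e : model_hom (E := ME) x y e = e :> MA.
    have [hZ hD hM hx hy] := model_homP wN ME_gens.
    apply: (@model_hom_ext _ _ phi n q a b wN MA _ id) => //.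
    by move=> r; rewrite hZ hM.1.
  elim/tensor_ind: t => [s e|s t IHs IHt].
    apply: (etrans (galois_via_tmul ME_comod ME_gens s e)).
    apply: (etrans _ (esym (galois_map_tmul ME_comod s e))).
    by rewrite hid.
  apply: (etrans (galois_viaD ME_comod ME_gens s t)).
  apply: (etrans _ (esym (galois_mapD ME_comod s t))).
  by rewrite IHs IHt.
have coef0 (c : R) : ((c *: (1 : MA) : MA) : {ffun _ -> R^o}) (ord0, ord0) = c.
  rewrite [LHS]ffunE -[RHS]mulr1; congr (_ * _).
  by rewrite (mono_ord a b (ord0, ord0)) eqxx.
split=> //; split; first exact: model_comodule_algebra.
  move=> c c' /(congr1 (fun f : MA => (f : {ffun _ -> R^o}) (ord0, ord0))).
  by rewrite !coef0.
move=> s; split=> [ds|[c ->]]; last exact: ME_comod.2.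
(* If s is coinvariant then 1 \ox s and s \ox 1 have the same Galois image. *)
pose co := (fun p (f : MA) => (f : {ffun 'I_N * 'I_N -> R^o}) p).
have ss : (1 : MA) \ox s = s \ox (1 : MA).
  apply: (bij_inj gal); apply: (etrans (galois_map_tmul ME_comod 1 s)).
  apply: (etrans _ (esym (galois_map_tmul ME_comod s 1))).
  by rewrite ds ME_comod.1.2.1 mulr1 mul1r.
(* The coordinate of the first tensor factor along the basis vector 1 turns 1 \ox s = s \ox 1 into s
   = co(s) 1. *)
exists (co (ord0, ord0) s).
have := congr1 (tensor_coord co (ord0, ord0)) ss.
rewrite !(tensor_coord_tmul (model_coord_basis a b wN)) => sE.
have c1 := coef0 1; rewrite scale1r in c1.
by rewrite -[RHS]sE [X in X *: _]c1 scale1r.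
Qed.

End ModelBundle.

(** * Generators of cleft bundles *)

Section Cleft.
Variables (k : fieldType) (H : hopfAlgebra k).
Variables (R : comNzRingType) (phi : {rmorphism k -> R}).
Variable E : extension_data H phi.
Hypothesis E_ext : is_extension E.
Local Notation EA := (ext_alg E).

(** The inverse of a coinvariant unit is again coinvariant, so both lie in the base, where
    injectivity of C -> A makes them inverse to each other. *)
Lemma coinvariant_unit (g g' : EA) :
    g * g' = 1 -> g' * g = 1 -> coact E g = (g : E) \ox (1 : H) ->
  exists d d' : R, d * d' = 1 /\ g = scalar_map EA d.
Proof.
move=> gg' g'g dg; have [[[_ [d1 dM]] _ _] inj coinv] := E_ext.
have dg' : coact E g' = (g' : E) \ox (1 : H).
  have gg1 : ((g : E) \ox (1 : H) : tensor_alg E H) * ((g' : E) \ox (1 : H)) = 1.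
    by rewrite tensor_mulM mulr1; congr (_ \ox _).
  rewrite -[LHS]mulr1 -gg1 mulrA -dg -dM.
  have -> : (g' : E) * (g : E) = 1 by exact: g'g.
  by rewrite d1 mul1r.
have /coinv[d gd] := dg; have /coinv[d' gd'] := dg'.
exists d, d'; split=> //; apply: inj.
have e : scalar_map EA (d * d') = scalar_map EA 1.
  by rewrite rmorphM rmorph1 -gg'; congr (_ * _); apply/esym.
exact: e.
Qed.

Variables (n : nat) (q : k) (X Y : H).
Local Notation N := n.+1.
Hypothesis n_gt0 : (0 < n)%N.
Hypothesis q_prim : N.-primitive_root q.
Hypothesis XY : taft_relations N q X Y.
Hypothesis comulX : comul X = X \ox X.
Hypothesis comulY : comul Y = (1 : H) \ox Y + Y \ox X.
Hypothesis counitX : counit X = 1.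

Lemma primitive_root_neq1 : q != 1.
Proof.
apply/eqP=> q1; have := prim_order_dvd q_prim 1.
by rewrite q1 expr1n eqxx dvdn1 eqSS; case: (n) n_gt0.
Qed.

Lemma cleft_taft_gens : cleft E -> exists a a' b (x y : EA),
  a * a' = 1 /\ taft_gens n q X Y a b x y.
Proof.
case=> gam [gam' [gl gcom gl' gconv]].
have [[[dl [d1 dM]] _ _] inj coinv] := E_ext.
have E_comod := extension_base_comodule E_ext.
have [XN YN YX] := XY; have [_ [D1 DM]] := comul_morph H.
have [_ [e1 _]] := counit_morph H.
have conv (f f' : H -> E) (u v : H) : linear f -> linear f' ->
    tlift (fun u v : H => f u * f' v : E) (u \ox v) = f u * f' v.
  move=> fl fl'; apply: (tliftE (f := fun u v : H => f u * f' v)).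
  split=> [s t w|s t w|r s t].
  - by rewrite (linear_funD fl) mulrDl.
  - by rewrite (linear_funD fl') mulrDr.
  - by rewrite (linear_funZ fl) (linear_funZ fl') -alg_scaleAl alg_scaleAr.
(* On a grouplike element the convolution identities say that [gam' u] is the inverse of [gam u]. *)
have grouplike (u : H) : comul u = u \ox u -> counit u = 1 ->
    [/\ gam u * gam' u = 1 :> EA, gam' u * gam u = 1 :> EA
      & coact E (gam u) = gam u \ox u].
  move=> Du eu; have [c1 c2] := gconv u.
  rewrite /convolution Du !conv // eu !scale1r in c1 c2.
  by split=> //; rewrite gcom Du tmap_tmul.
have [g1 g1' dg1] := grouplike 1 D1 e1.
have [d [d' [dV gd]]] := coinvariant_unit g1 g1' dg1.
have [xx' x'x dx] := grouplike X comulX counitX.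
pose x0 : EA := gam X; pose x' : EA := gam' X.
have dxX m : coact E (x0 ^+ m) = (x0 ^+ m : E) \ox (X ^+ m).
  by rewrite (monoid_morphismX (f := coact E)) // dx tensor_mulX.
have [a [a' [aV xa]]] : exists a a' : R, a * a' = 1 /\ x0 ^+ N = scalar_map EA a.
  apply: (@coinvariant_unit (x0 ^+ N) (x' ^+ N)).
  - by rewrite -exprMn_comm ?xx' ?expr1n // /GRing.comm [LHS]xx' [RHS]x'x.
  - by rewrite -exprMn_comm ?x'x ?expr1n // /GRing.comm [LHS]x'x [RHS]xx'.
  - by rewrite dxX XN.
(* A cleaving map need not send 1 to 1. The coaction of [gam Y] starts with [gam 1] \ox Y, where
   [gam 1] is the unit d of the base; dividing by d normalizes it. *)
pose y0 : EA := d' *: (gam Y : EA).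
have dy0 : coact E y0 = (1 : E) \ox Y + (y0 : E) \ox X.
  rewrite coactZ // gcom comulY (linear_funD (tmap_linear gl (@id_linear _ _))).
  rewrite !tmap_tmul // mulrDr !base_mapE; congr (_ \ox _ + _).
  by rewrite [gam 1]gd /scalar_map scalerA mulrC dV scale1r.
(* In the coaction of the q-commutator the terms containing Y cancel because YX = qXY, which leaves
   w \ox X^2. *)
pose w : EA := y0 * x0 - phi q *: (x0 * y0).
have dw : coact E w = (w : E) \ox (X ^+ 2).
  have -> : coact E w = coact E (y0 * x0) - coact E (phi q *: (x0 * y0)).
    by rewrite -[in RHS]scaleN1r -(linear_funZ dl) scaleN1r -(linear_funD dl).
  rewrite coactZ // !dM dx dy0 mulrDl mulrDr !tensor_mulM !mul1r !mulr1 mulrDr.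
  rewrite base_mapE base_map_phi -alg_scaleAl mul1r YX tensorZr opprD addrACA -!tmulZ.
  rewrite [X in X + _](_ : _ = 0) ?add0r; last exact: subrr.
  by rewrite -tmulNl -tmulDl expr2.
(* Here [n.-1] is N - 2, the exponent that completes X^2 to X^N = 1 and makes the product
   coinvariant. *)
have [c wc] : exists c, w * x0 ^+ n.-1 = c *: (1 : EA).
  apply/coinv; rewrite dM dw dxX tensor_mulM -exprD addSn add1n prednK // XN //.
have wE : w = (a' * c) *: x0 ^+ 2.
  rewrite -scalerA.
  have <- : w * x0 ^+ N = c *: x0 ^+ 2.
    by rewrite -[in RHS](mul1r (x0 ^+ 2)) alg_scaleAl -wc -mulrA -exprD addn2 prednK.
  by rewrite xa -scalar_map_comm scalar_mapE scalerA mulrC aV scale1r.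
(* Subtracting t x0 changes the q-commutator by -t (1 - q) x0^2, so t is the coefficient of x0^2 in
   w divided by 1 - q. The shape of the coaction is preserved. *)
pose y : EA := y0 - (a' * c * phi (1 - q)^-1) *: x0.
have yx : y * x0 = phi q *: (x0 * y).
  have q1 : phi (1 - q)^-1 * (1 - phi q) = 1.
    rewrite -(rmorph1 phi) -rmorphB -rmorphM mulVf ?rmorph1 //.
    by rewrite subr_eq0 eq_sym primitive_root_neq1.
  rewrite /y mulrBl mulrBr scalerBr -(subrK (phi q *: (x0 * y0)) (y0 * x0)) -/w wE.
  rewrite -!alg_scaleAl -!alg_scaleAr !scalerA -expr2 addrAC [RHS]addrC.
  congr (_ + _); rewrite -scalerBl -scaleNr; congr (_ *: _).
  have e : a' * c = a' * c * (phi (1 - q)^-1 * (1 - phi q)) by rewrite q1 mulr1.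
  by rewrite {1}e; ring.
have dy : coact E y = (1 : E) \ox Y + (y : E) \ox X.
  pose t := a' * c * phi (1 - q)^-1.
  have -> : coact E y = coact E y0 - coact E (t *: x0).
    by rewrite -[in RHS]scaleN1r -(linear_funZ dl) scaleN1r -(linear_funD dl).
  rewrite (coactZ t x0 E_comod) dx base_mapE dy0 -addrA -tmulNl -tmulDl //.
have [b yb] : exists b, y ^+ N = b *: (1 : EA).
  apply/coinv; rewrite (monoid_morphismX (f := coact E)) // dy.
  exact: (@coaction_yN k H R phi n q X Y q_prim XY (ext_alg E) y).
by exists a, a', b, x0, y; split=> //; split.
Qed.

End Cleft.

(** * Base change *)

(** The type of an extension depends on the bundled morphism from k, so pointwise equality has to
    become equality of bundled morphisms. *)
Lemma rmorphism_ext (A B : pzSemiRingType) (f g : {rmorphism A -> B}) :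
  f =1 g -> f = g.
Proof.
case: f g => f [[f0] [f1]] [g [[g0] [g1]]] /= /funext fg; subst g.
by congr (GRing.RMorphism.Pack (GRing.RMorphism.Class _ _)); congr (_ _);
  apply: Prop_irrelevance.
Qed.

Section Iso.
Variables (k : fieldType) (H : hopfAlgebra k).

Lemma comodule_alg_iso_sym (A B : coactedAlg H) :
  comodule_alg_iso A B -> comodule_alg_iso B A.
Proof.
case=> th [[thl [th1 thM]] [g gK gK'] thc].
have gl : linear g by move=> r x y; apply: (can_inj gK); rewrite thl !gK'.
have il := @id_linear k (alg_sort H).
have tK (t : tensor (alg_sort A) (alg_sort H)) : tmap g id (tmap th id t) = t.
  elim/tensor_ind: t => [a h|s t IHs IHt]; first by rewrite !tmap_tmul // gK.
  rewrite (linear_funD (tmap_linear thl il)) (linear_funD (tmap_linear gl il)).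
  by rewrite IHs IHt.
exists g; split; last by move=> b; rewrite -[LHS]tK -thc gK'.
- split=> //; split; first by apply: (can_inj gK); rewrite gK' th1.
  by move=> x y; apply: (can_inj gK); rewrite thM !gK'.
by exists th.
Qed.

Lemma comodule_alg_iso_trans (A B D : coactedAlg H) :
  comodule_alg_iso A B -> comodule_alg_iso B D -> comodule_alg_iso A D.
Proof.
case=> f [fm fb fc] [g [gm gb gc]]; exists (g \o f); split.
- exact: comp_algebra_morphism.
- exact: bij_comp.
move=> a /=; rewrite gc fc (tmap_comp _ fm.1 gm.1) //.
Qed.

End Iso.

Section CoordBasis.
Variables (R : comNzRingType) (M : lmodType R) (I : finType).
Variables (e : I -> M) (co : I -> M -> R).
Hypothesis e_basis : coord_basis e co.

Lemma eq_coord_basis (e' : I -> M) : e =1 e' -> coord_basis e' co.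
Proof.
have [col coe coE] := e_basis; move=> ee'; split=> // [i j|m].
  by rewrite -ee'.
by rewrite {1}(coE m); apply: eq_bigr => i _; rewrite ee'.
Qed.

Lemma coord_basis_scale (u v : I -> R) : (forall i, u i * v i = 1) ->
  coord_basis (fun i => u i *: e i) (fun i m => v i * co i m).
Proof.
move=> uv; have [col coe coE] := e_basis; split=> [i r x y|i j|m].
- rewrite (col i) mulrDr; congr (_ + _); exact: mulrCA.
- rewrite (linear_funZ (col i)) coe; case: eqP => [->|_]; last first.
    by rewrite scaler0 mulr0.
  by rewrite -[LHS]/(v j * (u j * 1)) mulr1 mulrC uv.
rewrite {1}(coE m); apply: eq_bigr => i _.
by rewrite scalerA mulrAC [v i * u i]mulrC uv mul1r.
Qed.

Lemma coord_basis_bij (M' : lmodType R) (f : M -> M') :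
  linear f -> bijective f -> exists co', coord_basis (fun i => f (e i)) co'.
Proof.
move=> fl [g fK gK]; have [col coe coE] := e_basis.
have gl : linear g by move=> r x y; apply: (can_inj fK); rewrite fl !gK.
exists (fun i m => co i (g m)); split=> [i r x y|i j|m].
- by rewrite gl (col i).
- by rewrite fK coe.
rewrite -[LHS]gK {1}(coE (g m)) (linear_fun_sum fl).
apply: eq_bigr => i _; rewrite (linear_funZ fl) //.
Qed.

End CoordBasis.

Section BaseChange.
Variables (R S : comNzRingType) (f : {rmorphism R -> S}) (A : assocAlg R).
Local Notation fA := (base_change f A).
Local Notation "s \os a" := (base_change_tmul f s a : fA) (at level 40).

Lemma base_change_mulE (s s' : S) (a a' : A) :
  (s \os a) * (s' \os a') = (s * s') \os (a * a').
Proof. exact: tensor_mulE. Qed.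

Lemma base_change_expE (s : S) (a : A) m : (s \os a) ^+ m = (s ^+ m) \os (a ^+ m).
Proof. by elim: m => // m IHm; rewrite !exprS IHm base_change_mulE. Qed.

Lemma base_change_tmulDl (s s' : S) (a : A) : (s + s') \os a = s \os a + s' \os a.
Proof. exact: tmulDl. Qed.

Lemma base_change_tmulDr (s : S) (a a' : A) : s \os (a + a') = s \os a + s \os a'.
Proof. exact: tmulDr. Qed.

Lemma base_change_tmulZ (s : S) (r : R) (a : A) : s \os (r *: a) = (f r * s) \os a.
Proof. exact/esym/tmulZ. Qed.

Lemma base_change_ind (P : fA -> Prop) : (forall s a, P (s \os a)) ->
  (forall t t', P t -> P t' -> P (t + t')) -> forall t, P t.
Proof. by move=> Pt PD t; apply: (@tensor_ind _ _ _ P). Qed.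

Lemma base_change_scalar s : scalar_map fA s = s \os (1 : A).
Proof. by rewrite /scalar_map (base_changeZ f s 1) mulr1. Qed.

Variables (I : finType) (e : I -> A) (co : I -> A -> R).
Hypothesis e_basis : coord_basis e co.

Lemma base_change_coord_basis : exists co',
  coord_basis (fun i => 1 \os e i) co'.
Proof.
have [col coe coE] := e_basis.
pose co' i : fA -> S := tlift (fun (s : restrict f (regular_alg S)) (a : A) =>
  (s : S) * f (co i a)).
have bal i : balanced (fun (s : restrict f (regular_alg S)) (a : A) =>
    (s : S) * f (co i a)).
  split=> [s s' a|s a a'|r s a].
  - exact: mulrDl.
  - by rewrite (linear_funD (col i)) rmorphD mulrDr.
  rewrite (linear_funZ (col i)) rmorphM mulrA; congr (_ * _); exact: mulrC.
have co'E i s a : co' i (s \os a) = s * f (co i a) by apply: tliftE.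
have co'D i : {morph co' i : t t' / t + t'} by exact: tliftD.
exists co'; split=> [i s t t'|i j|t].
- rewrite co'D; congr (_ + _).
  elim/base_change_ind: t => [s' a|u v IHu IHv].
    rewrite (base_changeZ f s s' a) !co'E; exact/esym/mulrA.
  by rewrite scalerDr !co'D IHu IHv; exact/esym/mulrDr.
- by rewrite co'E coe mul1r rmorph_nat.
elim/base_change_ind: t => [s a|u v IHu IHv]; last first.
  by rewrite {1}IHu {1}IHv -big_split; apply: eq_bigr => i _; rewrite co'D scalerDl.
rewrite {1}(coE a).
have tm0 : s \os (0 : A) = 0 by exact: tmul0r.
rewrite (big_morph (fun a => s \os a) (base_change_tmulDr s) tm0).
apply: eq_bigr => i _; rewrite base_change_tmulZ co'E.
by rewrite (base_changeZ f (s * f (co i a)) 1) mulr1 mulrC.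
Qed.

End BaseChange.

Section BaseChangeCoaction.
Variables (k : fieldType) (H : hopfAlgebra k).
Variables (R S : comNzRingType) (f : {rmorphism R -> S}) (A : assocAlg R).
Variable psi : {rmorphism k -> S}.
Local Notation fA := (base_change f A).
Local Notation DK := (restrict psi fA).
Variables (B : assocAlg k) (j : S -> B -> DK) (d : A -> tensor_alg B H).
Hypothesis j_linear : forall s, linear (j s).
Hypothesis jD : forall s s' b, j (s + s') b = j s b + j s' b.
Hypothesis jM : forall s s' b b', j (s * s') (b * b') = j s b * j s' b'.
Hypothesis j1 : forall s, j s 1 = scalar_map fA s.
Hypothesis dD : {morph d : a a' / a + a'}.
Hypothesis d_mon : monoid_morphism d.
Hypothesis dZ : forall s r a, tmap (j s) id (d (r *: a)) = tmap (j (f r * s)) id (d a).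

Let il := @id_linear k (alg_sort H).

(** Abstract in [j] and [d] to cover two coactions at once: the trivial extension, where [d] is the
    coproduct of H, and a push-forward, where [d] is the coaction of the bundle. *)
Definition base_change_coact : DK -> tensor_alg DK H :=
  tlift (fun (s : restrict f (regular_alg S)) (a : A) => tmap (j s) id (d a)).

Lemma base_change_coact_balanced :
  balanced (fun (s : restrict f (regular_alg S)) (a : A) => tmap (j s) id (d a)).
Proof.
split=> [s s' a|s a a'|r s a].
- elim/tensor_ind: (d a) => [b h|t t' IHt IHt'].
    by rewrite !tmap_tmul // jD tmulDl.
  by rewrite !(linear_funD (tmap_linear (j_linear _) il)) IHt IHt' addrACA.
- by rewrite dD (linear_funD (tmap_linear (j_linear _) il)).
by rewrite dZ.
Qed.

Lemma base_change_coactE (s : S) (a : A) :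
  base_change_coact (base_change_tmul f s a) = tmap (j s) id (d a).
Proof. exact/tliftE/base_change_coact_balanced. Qed.

Lemma base_change_coactD : {morph base_change_coact : t t' / t + t'}.
Proof. exact/tliftD/base_change_coact_balanced. Qed.

Lemma base_change_coact_comodule :
  base_comodule (ExtensionData (phi := psi) (H := H) base_change_coact).
Proof.
have d1 : base_change_coact 1 = 1.
  apply: (etrans (base_change_coactE 1 1)).
  rewrite d_mon.1; apply: (etrans (tmap_tmul _ _ (j_linear 1) il)).
  by congr (_ \ox _); rewrite j1 rmorph1.
have tjM s s' (t t' : tensor_alg B H) : tmap (j (s * s')) id (t * t') =
    (tmap (j s) id t : tensor_alg DK H) * tmap (j s') id t'.
  have tD s0 := linear_funD (tmap_linear (j_linear s0) il).
  elim/tensor_ind: t => [b h|t u IHt IHu]; last first.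
    by rewrite mulrDl !tD IHt IHu mulrDl.
  elim/tensor_ind: t' => [b' h'|t u IHt IHu]; last first.
    by rewrite mulrDr !tD IHt IHu mulrDr.
  by rewrite tensor_mulM !tmap_tmul // jM tensor_mulM.
have dM : {morph base_change_coact : t t' / t * t'}.
  move=> t t'; elim/base_change_ind: t => [s a|t u IHt IHu]; last first.
    rewrite [in LHS](_ : (t + u : DK) * t' = (t : DK) * t' + (u : DK) * t').
      by rewrite !base_change_coactD IHt IHu mulrDl.
    exact: mulrDl.
  elim/base_change_ind: t' => [s' a'|t u IHt IHu]; last first.
    rewrite [in LHS](_ : _ * (t + u : DK) =
      (base_change_tmul f s a : DK) * t + (base_change_tmul f s a : DK) * u).
      by rewrite !base_change_coactD IHt IHu mulrDr.
    exact: mulrDr.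
  rewrite [in LHS](_ : _ * _ = base_change_tmul f (s * s') (a * a')).
    by rewrite !base_change_coactE d_mon.2 tjM.
  exact: base_change_mulE.
have dr s : base_change_coact (scalar_map fA s) = base_map H psi fA s.
  rewrite base_change_scalar base_change_coactE d_mon.1 tmap_tmul // j1 //.
split=> //; split=> // c t t'.
rewrite [LHS]base_change_coactD; congr (_ + _).
rewrite [LHS](_ : _ = base_change_coact ((scalar_map fA (psi c) : DK) * t)).
  by rewrite dM dr base_map_phi -alg_scaleAl mul1r.
by congr base_change_coact; apply/esym; apply: (scalar_mapE (A := fA)).
Qed.

End BaseChangeCoaction.

Section PushForward.
Variables (k : fieldType) (H : hopfAlgebra k).
Variables (R : comNzRingType) (phi : {rmorphism k -> R}).

Lemma trivial_tmul_linear (s : R) :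
  linear (fun x : H => base_change_tmul phi s x : restrict phi (base_change phi H)).
Proof.
move=> c h h'; rewrite [LHS]base_change_tmulDr base_change_tmulZ; congr (_ + _).
exact/esym/(base_changeZ phi (phi c) s h).
Qed.

Lemma trivial_ext_coact : base_comodule (trivial_ext H phi) /\
  forall (s : R) (h : H), coact (trivial_ext H phi) (base_change_tmul phi s h) =
    tmap (fun x : H => base_change_tmul phi s x : restrict phi (base_change phi H))
      id (comul h).
Proof.
have [Dl Dmon] := comul_morph H; have il := @id_linear k (alg_sort H).
pose j s (x : H) : restrict phi (base_change phi H) := base_change_tmul phi s x.
have jl s : linear (j s) := trivial_tmul_linear s.
have jD s s' h : j (s + s') h = j s h + j s' h by exact: base_change_tmulDl.
have j1 s : j s 1 = scalar_map _ s by rewrite base_change_scalar.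
have jM s s' h h' : j (s * s') (h * h') = j s h * j s' h'.
  exact/esym/base_change_mulE.
have DD := linear_funD Dl.
have jZ s r h : tmap (j s) id (comul (r *: h)) = tmap (j (phi r * s)) id (comul h).
  rewrite (linear_funZ Dl).
  elim/tensor_ind: (comul h) => [b g|t t' IHt IHt'].
    by rewrite tensorZl !tmap_tmul // /j base_change_tmulZ.
  by rewrite scalerDr !(linear_funD (tmap_linear (jl _) il)) IHt IHt'.
split; first exact: (base_change_coact_comodule jl jD jM j1 DD Dmon jZ).
exact: (base_change_coactE jl jD DD jZ).
Qed.

Variables (S : comNzRingType) (f : {rmorphism R -> S}).
Variables (E : extension_data H phi).

Lemma push_forward_tmul_linear (s : S) :
  linear (fun x : E => base_change_tmul f s (x : ext_alg E)
    : restrict (f \o phi) (base_change f (ext_alg E))).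
Proof.
move=> c h h'; rewrite [LHS]base_change_tmulDr; congr (_ + _).
apply: (etrans (base_change_tmulZ f s (phi c) (h : ext_alg E))).
exact/esym/(base_changeZ f (f (phi c)) s (h : ext_alg E)).
Qed.

Lemma push_forward_coact : base_comodule E -> base_comodule (push_forward f E) /\
  forall (s : S) (a : ext_alg E), coact (push_forward f E) (base_change_tmul f s a) =
    tmap (fun x : E => base_change_tmul f s (x : ext_alg E)
            : restrict (f \o phi) (base_change f (ext_alg E)))
      id (coact E a).
Proof.
move=> E_comod; have [[dl dmon] _] := E_comod; have il := @id_linear k (alg_sort H).
pose j s (x : E) : restrict (f \o phi) (base_change f (ext_alg E)) :=
  base_change_tmul f s (x : ext_alg E).
have jl s : linear (j s) := push_forward_tmul_linear s.
have jD s s' a : j (s + s') a = j s a + j s' a by exact: base_change_tmulDl.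
have j1 s : j s 1 = scalar_map (base_change f (ext_alg E)) s.
  by rewrite base_change_scalar.
have jM s s' a a' : j (s * s') (a * a') = j s a * j s' a'.
  exact/esym/base_change_mulE.
have dD : {morph (coact E : ext_alg E -> _) : a a' / a + a'} := linear_funD dl.
have jZ s r (a : ext_alg E) :
    tmap (j s) id (coact E (r *: a)) = tmap (j (f r * s)) id (coact E a).
  rewrite coactZ //; elim/tensor_ind: (coact E a) => [b h|t t' IHt IHt'].
    rewrite base_mapE !tmap_tmul //; congr (_ \ox _); exact: base_change_tmulZ.
  by rewrite mulrDr !(linear_funD (tmap_linear (jl _) il)) IHt IHt'.
split; first exact: (base_change_coact_comodule jl jD jM j1 dD dmon jZ).
exact: (base_change_coactE jl jD dD jZ).
Qed.

End PushForward.

(** * Recognizing the comodule algebras E(a, b) by their monomial bases *)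

Section ModelIso.
Variables (k : fieldType) (H : hopfAlgebra k).
Variables (n : nat) (q : k) (X Y : H).
Local Notation N := n.+1.
Local Notation I := ('I_N * 'I_N)%type.
Hypothesis q_prim : N.-primitive_root q.
Hypothesis XY : taft_relations N q X Y.

Definition monomial_basis (R : comNzRingType) (A : assocAlg R) (x y : A) : Prop :=
  exists co, coord_basis (fun p : I => x ^+ p.1 * y ^+ p.2) co.

(** A monomial basis plays the part that descent has in [model_hom_bij]; this identifies
    push-forwards and the trivial extension without first showing that they are bundles. *)
Lemma model_iso (R : comNzRingType) (phi : {rmorphism k -> R}) a b
    (wN : phi q ^+ N = 1) (E : extension_data H phi) (x y : ext_alg E) :
    base_comodule E -> taft_gens n q X Y a b x y -> monomial_basis x y ->
  comodule_alg_iso (model_ext X Y a b wN) E.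
Proof.
move=> E_comod E_gens [co [col coe coE]].
have [hZ hD hM hx hy] := model_homP wN E_gens.
pose M := {ffun I -> R^o}.
have hE (s : M) : model_hom (wN := wN) x y s = \sum_p s p *: (x ^+ p.1 * y ^+ p.2).
  by apply: eq_bigr => p _; rewrite scalar_mapE.
exists (@model_hom k H R phi n q a b wN E x y); split.
- exact: model_hom_morphism E_gens.
- exists (fun t => [ffun p => co p t] : M) => [s|t].
    apply/ffunP=> p; rewrite ffunE hE (linear_fun_sum (col p)).
    rewrite (bigD1 p) //= (linear_funZ (col p)) coe eqxx big1 ?addr0 => [|r rp].
      exact: mulr1.
    by rewrite (linear_funZ (col p)) coe eq_sym (negPf rp) scaler0.
  by rewrite hE [RHS]coE; apply: eq_bigr => p _; rewrite ffunE.
- by move=> s; apply: model_hom_coact.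
Qed.

Lemma model_monomial_basis (R : comNzRingType) (w a b : R) (wN : w ^+ N = 1) :
  monomial_basis (model_x a b wN) (model_y a b wN).
Proof. exact: ex_intro (model_coord_basis a b wN). Qed.

Section PushForwardModel.
Variables (R S : comNzRingType) (phi : {rmorphism k -> R}) (f : {rmorphism R -> S}).
Variables (a b : R) (E : extension_data H phi) (x y : ext_alg E).
Hypotheses (E_comod : base_comodule E) (E_gens : taft_gens n q X Y a b x y).
Hypothesis xy_basis : monomial_basis x y.
Variables (u u' : S) (a1 : S).
Hypotheses (uV : u * u' = 1) (a1E : u ^+ N * f a = a1).

(** The new generators are u \ox x and 1 \ox y: rescaling x by a unit u multiplies a by u^N and
    leaves b, the q-commutation and the coactions intact. *)
Lemma push_forward_model (psi : {rmorphism k -> S}) (wN : psi q ^+ N = 1) :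
  psi =1 f \o phi -> comodule_alg_iso (model_ext X Y a1 (f b) wN) (push_forward f E).
Proof.
move=> /rmorphism_ext psiE; subst psi.
have [F_comod F_coact] := push_forward_coact f E_comod.
have [[dl [d1 _]] _] := E_comod; have [xN yN yx dx dy] := E_gens.
pose xF : ext_alg (push_forward f E) := base_change_tmul f u x.
pose yF : ext_alg (push_forward f E) := base_change_tmul f 1 y.
have jl := @push_forward_tmul_linear k H R phi S f E.
have il := @id_linear k (alg_sort H).
have scE s r :
    base_change_tmul f s (scalar_map (ext_alg E) r) = scalar_map _ (s * f r).
  by rewrite /scalar_map base_change_tmulZ -(base_change_scalar f (ext_alg E)) mulrC.
have F_gens : taft_gens n q X Y (E := push_forward f E) a1 (f b) xF yF.
  split.
  - by rewrite base_change_expE xN scE a1E.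
  - by rewrite base_change_expE yN scE expr1n mul1r.
  - rewrite !base_change_mulE yx base_change_tmulZ (base_changeZ f (f (phi q))).
    by rewrite mul1r mulr1.
  - by rewrite F_coact dx tmap_tmul.
  rewrite F_coact dy (linear_funD (tmap_linear (jl _) il)) !tmap_tmul //.
apply: (model_iso wN F_comod F_gens).
have [co /(base_change_coord_basis f)[co' co'B]] := xy_basis.
have upV (p : I) : u ^+ p.1 * u' ^+ p.1 = 1 by rewrite -exprMn uV expr1n.
have co''B := coord_basis_scale co'B upV.
exists (fun (p : I) (t : base_change f (ext_alg E)) => u' ^+ p.1 * co' p t).
apply: (eq_coord_basis co''B) => p.
rewrite !base_change_expE expr1n base_change_mulE mulr1.
by rewrite (base_changeZ f) mulr1.
Qed.

End PushForwardModel.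
End ModelIso.

Section Trivial.
Variables (k : fieldType) (H : hopfAlgebra k).
Variables (n : nat) (q : k) (X Y : H).
Local Notation N := n.+1.
Hypothesis q_prim : N.-primitive_root q.
Hypothesis XY : taft_relations N q X Y.
Hypothesis comulX : comul X = X \ox X.
Hypothesis comulY : comul Y = (1 : H) \ox Y + Y \ox X.
Hypothesis H_basis : exists co,
  coord_basis (fun p : 'I_N * 'I_N => X ^+ p.1 * Y ^+ p.2 : H) co.
Variables (R : comNzRingType) (phi : {rmorphism k -> R}).
Hypothesis wN : phi q ^+ N = 1.

Lemma model_trivial : comodule_alg_iso (model_ext X Y 1 0 wN) (trivial_ext H phi).
Proof.
have [T_comod T_coact] := trivial_ext_coact H phi.
have il := @id_linear k (alg_sort H); have [XN YN YX] := XY.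
have jl := @trivial_tmul_linear k H R phi.
pose xT : ext_alg (trivial_ext H phi) := base_change_tmul phi 1 X.
pose yT : ext_alg (trivial_ext H phi) := base_change_tmul phi 1 Y.
have T_gens : taft_gens n q X Y (E := trivial_ext H phi) 1 0 xT yT.
  split.
  - by rewrite base_change_expE XN expr1n -(base_change_scalar phi H).
  - by rewrite base_change_expE YN /scalar_map scale0r; exact: tmul0r.
  - rewrite !base_change_mulE YX base_change_tmulZ (base_changeZ phi (phi q)).
    by rewrite mul1r.
  - by rewrite T_coact comulX tmap_tmul.
  by rewrite T_coact comulY (linear_funD (tmap_linear (jl _) il)) !tmap_tmul.
apply: (model_iso q_prim XY wN T_comod T_gens).
have [co /(base_change_coord_basis phi)[co' co'B]] := H_basis.
exists co'; apply: (eq_coord_basis co'B) => p.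
by rewrite !base_change_expE !expr1n base_change_mulE mulr1.
Qed.

End Trivial.

(** * The homotopy over the root extension *)

Theorem theorem4p7 (k : fieldType) (N : nat) (q : k) (H : hopfAlgebra k)
    (C : comNzRingType) (phi : {rmorphism k -> C}) (A : bundle H phi) :
  (2 < N)%N -> N.-primitive_root q -> is_taft N q H ->
  (exists u : C, u * N%:R = 1) ->
  cleft A ->
  homotopically_trivial A.
Proof.
case: N => // n N2 q_prim [X [Y [XY H_univ H_dim [comulX comulY] [counitX counitY]]]].
move=> [u uN] A_cleft.
have qN : q ^+ n.+1 = 1 by apply: prim_expr_order.
have n_gt0 : (0 < n)%N by rewrite -ltnS ltnW.
have H_basis := taft_basis qN H_univ H_dim.
have wN (R : comNzRingType) (f : {rmorphism k -> R}) : f q ^+ n.+1 = 1.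
  by rewrite -rmorphXn qN rmorph1.
have bundleM (R : comNzRingType) (f : {rmorphism k -> R}) (b : R) :
    is_bundle (model_ext X Y 1 b (wN R f)).
  exact: (model_bundle q_prim XY H_univ H_dim comulX comulY counitX counitY b
            (wN R f) (mulr1 1)).
have [A_ext A_gal A_ff] := bundleP A.
have A_comod := extension_base_comodule A_ext.
have [a [a' [b [x [y [aV A_gens]]]]]] :=
  cleft_taft_gens A_ext n_gt0 q_prim XY comulX comulY counitX A_cleft.
(* The only use of descent: faithful flatness of A yields its monomial basis. *)
have A_basis : monomial_basis n x y.
  have hom_bij := model_hom_bij q_prim H_univ H_dim (wN C phi) aV (bundleP A) A_gens.
  have [hZ hD hM hx hy] := model_homP (wN C phi) A_gens.
  have hl : linear (@model_hom k H C phi n q a b (wN C phi) A x y).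
    by move=> r s t; rewrite hD hZ.
  have [co coB] := coord_basis_bij (model_coord_basis a b (wN C phi)) hl hom_bij.
  exists co; apply: (eq_coord_basis coB) => p.
  by rewrite hM.2 !(monoid_morphismX hM) hx hy.
have [Cb [i [z [z' [i_et zN zV]]]]] := root_adjunction aV uN.
pose T := Bundle (bundleM C phi 0).
pose psi : {rmorphism k -> Cb} := i \o phi.
(* The homotopy E(1, tb) over Cb[t]. *)
pose B := Bundle (bundleM {poly Cb} (polyC \o psi) ('X * (i b)%:P)).
have model_comod (R : comNzRingType) (f : {rmorphism k -> R}) (c : R) :=
  model_base_comodule q_prim XY 1 c (wN R f).
have model_gens (R : comNzRingType) (f : {rmorphism k -> R}) (c : R) :=
  let: And4 _ _ _ g := model_coact_hom q_prim XY 1 c (wN R f) in g.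
have A_iso : comodule_alg_iso (model_ext X Y 1 (i b) (wN Cb psi)) (push_forward i A).
  (* The generator x is replaced by x/z, whose N-th power is a/z^N = 1. *)
  apply: (push_forward_model q_prim XY A_comod A_gens A_basis (u := z') (u' := z)) => //.
    by rewrite mulrC.
  by rewrite -zN -exprMn mulrC zV expr1n.
(* E(1, c) commutes with base change; this serves for the two evaluations of [B] and for the
   push-forward of [T] along [i]. *)
have pf_iso (R S : comNzRingType) (f : {rmorphism R -> S}) (chi : {rmorphism k -> R})
    (c : R) (d : S) (chi' : {rmorphism k -> S}) : f c = d -> chi' =1 f \o chi ->
  comodule_alg_iso (model_ext X Y 1 d (wN S chi'))
    (push_forward f (model_ext X Y 1 c (wN R chi))).
  move=> <- chiE.
  apply: (push_forward_model q_prim XY (model_comod R chi c)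
            (model_gens R chi c) _ (mulr1 1)) => //.
    exact: model_monomial_basis.
  by rewrite expr1n rmorph1 mulr1.
have B_iso c d : c * i b = d ->
    comodule_alg_iso (model_ext X Y 1 d (wN Cb psi)) (push_forward (horner_eval c) B).
  move=> cd; apply: pf_iso => [|r].
    by rewrite rmorphM /= /horner_eval hornerX hornerC.
  by rewrite /= /horner_eval hornerC.
exists T; first exact: model_trivial.
(* The path runs from [T] at 0 to A at 1, hence the symmetry. *)
apply/rst_sym/rst_step; exists Cb, i, B; split=> //.
  apply: (comodule_alg_iso_trans (comodule_alg_iso_sym (B_iso 0 0 (mul0r _)))).
  by apply: pf_iso; rewrite ?rmorph0.
exact: (comodule_alg_iso_trans (comodule_alg_iso_sym (B_iso 1 (i b) (mul1r _))) A_iso).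
Qed.
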